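(* Consider the closed-loop system and the learning-based tube MPC scheme described in the context. Let $\epsilon,\gamma\in(0,1)$ and suppose that the set $\mathcal{I}^w_k$ of disturbance samples at time step $k$ satisfies $|\mathcal{I}^w_k|\ge\frac1\epsilon\frac{{\rm e}}{{\rm e}-1}\bigl(\ln\frac1\gamma+n_x\bigr)$, where ${\rm e}$ is Euler's number. Suppose that at time step $k$ the problem ${\rm OPT}(\hat{\mathbb{S}}^\star_k,h^\star_k,\nu_k)$ is feasible. Then, with confidence no less than $1-\gamma$, the problem ${\rm OPT}(\hat{\mathbb{S}}^\star_{k+1},h^\star_{k+1},\nu_{k+1})$ is feasible with probability at least $1-\epsilon$.
   Context: Vector inequalities and maxima of vector-valued expressions are componentwise; $\bm{1}$, $\bm{0}$ are all-ones and all-zeros matrices of appropriate size; $\oplus$ is the Minkowski sum; $|\cdot|$ is cardinality; $\|x\|_P^2=x^TPx$. System: $x_{k+1}=Ax_k+Bu_k+w_k$ with $x_k\in\mathbb{R}^{n_x}$, $u_k\in\mathbb{R}^{n_u}$, $(A,B)$ known and stabilisable, subject to $Fx_k+Gu_k\le\bm{1}$, where $F\in\mathbb{R}^{n_c\times n_x}$, $G\in\mathbb{R}^{n_c\times n_u}$. The state is measured exactly. The disturbances $w_k$ are i.i.d. with unknown distribution ${\rm Pr}$ whose support is a convex set $\mathbb{W}_{\rm true}\subseteq\mathbb{W}$, where $\mathbb{W}=\{w\in\mathbb{R}^{n_x}\mid Vw\le\bm{1}\}$ is a known compact convex polytope. Gain: $Q\succcurlyeq0$, $R\succ0$, $(A,Q)$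 observable, $P_x\succ0$ is the unique solution of $P_x=A^TP_xA+Q-A^TP_xB(B^TP_xB+R)^{-1}B^TP_xA$, $K=-(B^TP_xB+R)^{-1}B^TP_xA$, and $\Phi=A+BK$, which is strictly stable. $N$ is the prediction horizon and $P_c={\rm diag}\{B^TP_xB+R,\dots,B^TP_xB+R\}$ ($N$ blocks). Learning: for $v\in\mathbb{W}$, $\alpha\in[0,1]$ let $\mathcal{W}(v,\alpha)=(1-\alpha)v\oplus\alpha\mathbb{W}$. $\mathcal{I}^w_k$ is the set of i.i.d. disturbance samples from ${\rm Pr}$ available at time $k$. The quantified disturbance set at time $k$ is $\hat{\mathbb{W}}^\star_k=\mathcal{W}(v^\star_k,\alpha^\star_k)$, where $(y^\star_k,\beta^\star_k)$ is the optimiser of the linear program: maximise $\beta$ over $(y,\beta)$ subject to $-Vy\le(1-\beta)\bm{1}-Vw^s$ for all $w^s\in\mathcal{I}^w_k$, $Vy\le\beta\bm{1}$, $\beta\in[0,1]$; $\alpha^\star_k=1-\beta^\star_k$, and $v^\star_k=y^\star_k/\beta^\star_k$ if $\beta^\star_k>0$ (if $\beta^\star_k=0$ then $\hat{\mathbb{W}}^\star_k=\mathbb{W}$ for any choice of $v^\star_k\in\mathbb{W}$). Online update: at time $k+1$ the realisation $w_k=x_{k+1}-Ax_k-Bu_k$ is recovered. If $w_k\in\hat{\mathbb{W}}^\star_k$, then $(v^\star_{k+1},\alpha^\star_{k+1})=(v^\star_k,\alpha^\star_k)$; otherwise $$(v^\star_{k+1},\alpha^\star_{k+1})=\mathop{\rm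 argmin}_{v,\alpha}\{\alpha\mid \hat{\mathbb{W}}^\star_k\subseteq\mathcal{W}(v,\alpha),\ w_k\in\mathcal{W}(v,\alpha),\ v\in\mathbb{W},\ \alpha\in[0,1]\}.$$ Then $\hat{\mathbb{W}}^\star_{k+1}=\mathcal{W}(v^\star_{k+1},\alpha^\star_{k+1})$. Tubes: $r$ is a finite integer and $\rho\in[0,1)$ with $\Phi^r\mathbb{W}\subseteq\rho\mathbb{W}$; $\mathbb{S}=\frac1{1-\rho}\bigoplus_{i=0}^{r-1}\Phi^i\mathbb{W}$ (known to be compact, convex, with $\Phi\mathbb{S}\oplus\mathbb{W}\subseteq\mathbb{S}$). For $j\in\{k,k+1\}$: $\hat{\mathbb{S}}^\star_j=\alpha^\star_j\mathbb{S}\oplus(1-\alpha^\star_j)(I-\Phi)^{-1}v^\star_j$ and $h^\star_j=\max_{e\in\hat{\mathbb{S}}^\star_j}(F+GK)e$. Prediction matrices: $\bar F=\begin{bmatrix}F+GK & GE\end{bmatrix}$, $\Psi=\begin{bmatrix}\Phi & BE\\ \bm{0}& M\end{bmatrix}$, $E=\begin{bmatrix}I_{n_u}&\bm{0}&\cdots&\bm{0}\end{bmatrix}\in\mathbb{R}^{n_u\times Nn_u}$, and $M$ is the block-upshift operator $M(c_0,\dots,c_{N-1})=(c_1,\dots,c_{N-1},\bm{0})$, $c_i\in\mathbb{R}^{n_u}$. The integer $\nu_j$ is positive and such that $\bar F\Psi^{\nu_j+1}z\le\bm{1}-h^\star_j$ for all $z$ satisfying $\bar F\Psi^iz\le\bm{1}-h^\star_j$,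 $i=0,\dots,\nu_j$. MPC problem at time $j$ with measured state $x_j$: ${\rm OPT}(\hat{\mathbb{S}}^\star_j,h^\star_j,\nu_j)$ is $$\min_{s_{0|j},\bm{c}_j}\ \|s_{0|j}\|_{P_x}^2+\|\bm{c}_j\|_{P_c}^2\quad\text{s.t.}\quad x_j-s_{0|j}\in\hat{\mathbb{S}}^\star_j,\quad \bar F\Psi^i\begin{bmatrix}s_{0|j}\\ \bm{c}_j\end{bmatrix}\le\bm{1}-h^\star_j,\ i=0,\dots,\nu_j,$$ with $\bm{c}_j=[c_{0|j}^T\ \cdots\ c_{N-1|j}^T]^T\in\mathbb{R}^{Nn_u}$. The applied input is $u_j=Kx_j+c^\star_{0|j}$, where $c^\star_{0|j}$ is the first block of the optimal $\bm{c}_j$.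
   Formalization: The linear program may have several optimisers (e.g. when W is a box), so ''the optimiser'' is taken to be the one selected by a fixed tie-break: successive minimisation of convex continuous functions of y leaving at most one point; a unique optimiser is covered as a special case. *)

(* Defs.v *)
From HB Require Import structures.
From mathcomp Require Import all_boot all_order all_algebra.
From mathcomp Require Import all_classical all_reals all_analysis.
From mathcomp Require Export complex.

Set Implicit Arguments.
Unset Strict Implicit.
Unset Printing Implicit Defensive.

Import Order.TTheory GRing.Theory Num.Theory.
Import numFieldNormedType.Exports.

Local Open Scope classical_set_scope.
Local Open Scope ring_scope.

(* R^n with its Borel sigma-algebra *)
Notation borel_cV R n := (g_sigma_algebraType (@open 'cV[R]_n)).

Section linear_algebra.
Context {R : realType}.

Definition lecv n (x y : 'cV[R]_n) : Prop := forall i, x i 0 <= y i 0.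

Definition qform n (P : 'M[R]_n) (x : 'cV[R]_n) : R := (x^T *m P *m x) 0 0.

Definition posdef n (P : 'M[R]_n) : Prop :=
  P^T = P /\ forall x, x != 0 -> 0 < qform P x.

Definition possemidef n (P : 'M[R]_n) : Prop :=
  P^T = P /\ forall x, 0 <= qform P x.

Definition strictly_stable n (M : 'M[R]_n) : Prop :=
  forall l : R[i], eigenvalue (map_mx (real_complex R) M) l -> `|l| < 1.

Definition stabilisable n p (A : 'M[R]_n) (B : 'M[R]_(n, p)) : Prop :=
  exists L : 'M[R]_(p, n), strictly_stable (A + B *m L).

Definition observable n p (A : 'M[R]_n) (C : 'M[R]_(p, n)) : Prop :=
  forall x : 'cV[R]_n, (forall k : nat, C *m A ^+ k *m x = 0) -> x = 0.

Definition riccati n p (A : 'M[R]_n) (B : 'M[R]_(n, p)) (Q : 'M[R]_n)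
    (Rc : 'M[R]_p) (P : 'M[R]_n) : Prop :=
  P = A^T *m P *m A + Q
      - A^T *m P *m B *m invmx (B^T *m P *m B + Rc) *m B^T *m P *m A.

End linear_algebra.

Notation "x <=v y" := (lecv x y) (at level 70, no associativity) : ring_scope.

Section sets.
Context {R : realType}.

Definition msum n (X Y : set 'cV[R]_n) : set 'cV[R]_n :=
  [set a + b | a in X & b in Y].

Definition mxset m n (M : 'M[R]_(m, n)) (X : set 'cV[R]_n) : set 'cV[R]_m :=
  [set M *m x | x in X].

Definition scset n (a : R) (X : set 'cV[R]_n) : set 'cV[R]_n :=
  [set a *: x | x in X].

Definition polytope nV n (V : 'M[R]_(nV, n)) : set 'cV[R]_n :=
  [set w | V *m w <=v const_mx 1].

Definition homothet n (W : set 'cV[R]_n) (v : 'cV[R]_n) (a : R) :=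
  msum [set (1 - a) *: v] (scset a W).

End sets.

Section probability_notions.
Context {R : realType}.

Definition law_support n (Pr : probability (borel_cV R n) R) : set 'cV[R]_n :=
  [set w | forall U : set 'cV[R]_n, open U -> U w -> (0 < Pr U)%E].

(* The product rule for sub-families is the case of events equal to setT. *)
Definition iid d (Om : measurableType d) (P : probability Om R) n
    (Pr : probability (borel_cV R n) R) m
    (X : 'I_m -> {RV P >-> borel_cV R n}) : Prop :=
  (forall i (D : set (borel_cV R n)), measurable D ->
     P (X i @^-1` D) = Pr D) /\
  (forall D : 'I_m -> set (borel_cV R n), (forall i, measurable (D i)) ->
     P [set o | forall i, D i (X i o)] = (\prod_(i < m) P (X i @^-1` D i))%E).

(* "E has probability at least p", meaning P E >= p when E is measurable. The
   events below involve solutions of optimisation problems that need not depend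
   measurably on the data; for those the inner probability is used. *)
Definition prob_ge d (T : measurableType d) (P : probability T R)
    (E : set T) (p : R) : Prop :=
  exists2 D : set T, measurable D /\ D `<=` E & (p%:E <= P D)%E.

End probability_notions.

Section learning.
Context {R : realType}.

Definition lp_feasible nV n (V : 'M[R]_(nV, n)) m (ws : 'I_m -> 'cV[R]_n) :
    set ('cV[R]_n * R) :=
  [set z | (forall s, - (V *m z.1) <=v (1 - z.2) *: const_mx 1 - V *m ws s) /\
           V *m z.1 <=v z.2 *: const_mx 1 /\
           0 <= z.2 <= 1].

Definition lp_solutions nV n (V : 'M[R]_(nV, n)) m (ws : 'I_m -> 'cV[R]_n) :
    set ('cV[R]_n * R) :=
  [set z | lp_feasible V ws z /\
           forall z', lp_feasible V ws z' -> z'.2 <= z.2].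

Fixpoint lexmin (T : Type) (ts : seq (T -> R)) (X : set T) : set T :=
  if ts is t :: ts' then
    lexmin ts' [set x | X x /\ forall x', X x' -> t x <= t x']
  else X.

(* The linear program may have several solutions (y, beta), all with the same
   beta. "The" optimiser is singled out by a Calafiore-Campi tie-break rule: a
   list ts of convex continuous functions of y, minimised successively over the
   set of solutions. The rule [::] amounts to assuming that the linear program
   has only one solution; coordinate functions give the lexicographic rule. *)
Definition lp_optimiser nV n (V : 'M[R]_(nV, n)) (ts : seq ('cV[R]_n -> R))
    m (ws : 'I_m -> 'cV[R]_n) : set ('cV[R]_n * R) :=
  lexmin [seq (fun z : 'cV[R]_n * R => t z.1) | t <- ts] (lp_solutions V ws).

Definition tie_break_rule nV n (V : 'M[R]_(nV, n)) (ts : seq ('cV[R]_n -> R))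
    m (Wtrue : set 'cV[R]_n) : Prop :=
  (forall j, (j < size ts)%N ->
     continuous (nth (fun=> 0) ts j) /\
     convex_function setT (nth (fun=> 0) ts j)) /\
  (forall ws : 'I_m -> 'cV[R]_n, (forall s, Wtrue (ws s)) ->
     is_subset1 (lp_optimiser V ts ws)).

Definition quantified_by n (W : set 'cV[R]_n) (y : 'cV[R]_n) (beta : R)
    (v : 'cV[R]_n) (alpha : R) : Prop :=
  alpha = 1 - beta /\ (0 < beta -> v = beta^-1 *: y) /\ (beta = 0 -> W v).

Definition update_candidate n (W : set 'cV[R]_n) (v0 : 'cV[R]_n) (alpha0 : R)
    (w v : 'cV[R]_n) (alpha : R) : Prop :=
  [/\ homothet W v0 alpha0 `<=` homothet W v alpha,
      homothet W v alpha w, W v & 0 <= alpha <= 1].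

Definition online_update n (W : set 'cV[R]_n) (v0 : 'cV[R]_n) (alpha0 : R)
    (w v1 : 'cV[R]_n) (alpha1 : R) : Prop :=
  (homothet W v0 alpha0 w -> v1 = v0 /\ alpha1 = alpha0) /\
  (~ homothet W v0 alpha0 w ->
     update_candidate W v0 alpha0 w v1 alpha1 /\
     forall v alpha, update_candidate W v0 alpha0 w v alpha -> alpha1 <= alpha).

End learning.

Section tube_mpc.
Context {R : realType}.

Definition tube n (Phi : 'M[R]_n) (W : set 'cV[R]_n) (r : nat) (rho : R) :=
  scset (1 - rho)^-1 (\big[@msum R n/[set 0]]_(0 <= i < r) mxset (Phi ^+ i) W).

Definition quantified_tube n (Phi : 'M[R]_n) (S : set 'cV[R]_n)
    (v : 'cV[R]_n) (alpha : R) :=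
  msum (scset alpha S) [set (1 - alpha) *: (invmx (1%:M - Phi) *m v)].

(* componentwise maximum over X of C *m e; it is attained for X compact *)
Definition max_over p n (C : 'M[R]_(p, n)) (X : set 'cV[R]_n) : 'cV[R]_p :=
  \col_i sup [set (C *m e) i 0 | e in X].

Variables (nx nu nc N : nat).

(* input sequences (c_0, ..., c_(N-1)) *)
Notation inputs := 'cV[R]_(\sum_(j < N) nu).

Definition first_block : 'M[R]_(nu, \sum_(j < N) nu) :=
  \mxrow_(j < N) (if j == 0%N :> nat then 1%:M else 0).

Definition upshift : 'M[R]_(\sum_(j < N) nu) :=
  \mxblock_(i < N, j < N) (if j == i.+1 :> nat then 1%:M else 0 : 'M[R]_nu).

Definition Fbar_mx (F : 'M[R]_(nc, nx)) (G : 'M[R]_(nc, nu))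
    (K : 'M[R]_(nu, nx)) : 'M[R]_(nc, nx + \sum_(j < N) nu) :=
  row_mx (F + G *m K) (G *m first_block).

Definition Psi_mx (Phi : 'M[R]_nx) (B : 'M[R]_(nx, nu)) :
    'M[R]_(nx + \sum_(j < N) nu) :=
  block_mx Phi (B *m first_block) 0 upshift.

Definition horizon_admissible p (Fbar : 'M[R]_(nc, p)) (Psi : 'M[R]_p)
    (h : 'cV[R]_nc) (nuj : nat) : Prop :=
  (0 < nuj)%N /\
  forall z : 'cV[R]_p,
    (forall i, (i <= nuj)%N -> Fbar *m Psi ^+ i *m z <=v const_mx 1 - h) ->
    Fbar *m Psi ^+ nuj.+1 *m z <=v const_mx 1 - h.

Definition opt_constraints (Fbar : 'M[R]_(nc, nx + \sum_(j < N) nu))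
    (Psi : 'M[R]_(nx + \sum_(j < N) nu)) (S : set 'cV[R]_nx) (h : 'cV[R]_nc)
    (nuj : nat) (x : 'cV[R]_nx) : set ('cV[R]_nx * inputs) :=
  [set sc | S (x - sc.1) /\
     forall i, (i <= nuj)%N ->
       Fbar *m Psi ^+ i *m col_mx sc.1 sc.2 <=v const_mx 1 - h].

Definition opt_feasible Fbar Psi S h nuj x : Prop :=
  opt_constraints Fbar Psi S h nuj x !=set0.

Definition opt_cost (Px : 'M[R]_nx) (D : 'M[R]_nu)
    (sc : 'cV[R]_nx * inputs) : R :=
  qform Px sc.1 + qform (\mxdiag_(j < N) D) sc.2.

Definition opt_minimiser (Px : 'M[R]_nx) (D : 'M[R]_nu) Fbar Psi S h nuj x
    (sc : 'cV[R]_nx * inputs) : Prop :=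
  opt_constraints Fbar Psi S h nuj x sc /\
  forall sc', opt_constraints Fbar Psi S h nuj x sc' ->
    opt_cost Px D sc <= opt_cost Px D sc'.

End tube_mpc.

(* Main.v *)
Require Import Defs.
From HB Require Import structures.
From mathcomp Require Import all_boot all_order all_algebra.
From mathcomp Require Import all_classical all_reals all_analysis.
From mathcomp Require Import measurable_realfun ring lra zify.

Set Implicit Arguments.
Unset Strict Implicit.
Unset Printing Implicit Defensive.

Import Order.TTheory GRing.Theory Num.Theory.
Import numFieldNormedType.Exports.

Local Open Scope ring_scope.

(* If the new disturbance lies in the quantified set, nothing is updated, the
   quantified tube is invariant, and the shifted solution (Psi z) is feasible
   because nu_k makes the constraints hold over the whole prediction. So the
   claim is a bound on the violation probability of the optimiser of a convex
   program in the d + 1 = n_x + 1 variables (y, beta) with m random constraints: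
     x^d P(violation > eps) <= (1 - (1 - x) eps)^m   for 0 < x <= 1,
   taken at x = 1/e.  For the bound, consider n >> m samples.  By Radon's theorem
   the optimum of a set of samples is the optimum of at most d + 1 of them, and
   after a generic perturbation this support C is unique, so that the sets of
   samples with support C form an interval [C, U].  Counting all sets of each
   cardinality through these intervals bounds the number of m-sets whose optimum
   is violated by at least k of the n samples.  By exchangeability the same
   bound holds on average for the first m samples, whose optimum, if its
   violation probability exceeds eps, is violated by about eps n samples with
   high probability; then n tends to infinity. *)

(** * Counting sets of samples by their supports *)

(** The counts of r-sets give one identity for each r > d, and these do not determine how many
    intervals [[C, U]] have given end sizes; the weights [lam] act as a dual certificate. They are
    fixed by the supports of maximal size; for smaller supports, Pascal's rule turns the same
    weights into repeated sums of the same sequence. The total is compared with powers of a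
    piecewise linear function, of slope 1 and then [x]. The first summation only meets the part of
    slope 1, so d + 1 summations cost [x ^+ d].

    Nondegeneracy meets an obstacle: a lexicographic optimum need not depend continuously on the
    right-hand sides. A small relaxation may improve the first objective slightly and make the
    tie-break jump, and the violators of the original optimum would be lost. So each possible
    original optimum [z] gets its own relaxed program, whose first objective only detects whether
    [z] is the optimum; these programs are then glued along the classes of sets with optimum [z].

    The choice x = 1/e turns 1/(1 - x) into e/(e - 1), and [x ^+ d] into the term n_x of the sample
    size. *)

(** The system is triangular with diagonal ['C(s, s) = 1], hence solvable over any ring. *)
Lemma exists_binomial_transform (R : nzRingType) (g : nat -> R) (N : nat) :
  exists lam : nat -> R, forall s, (s < N)%N ->
    \sum_(j < N) lam j * 'C(s, j)%:R = g s.
Proof.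
elim: N => [|N [lam hlam]]; first by exists (fun=> 0).
exists (fun j => if j == N then g N - \sum_(j < N) lam j * 'C(N, j)%:R
                 else lam j) => s.
have lamE : \sum_(j < N) (if j == N :> nat
    then g N - \sum_(j < N) lam j * 'C(N, j)%:R else lam j) * 'C(s, j)%:R
    = \sum_(j < N) lam j * 'C(s, j)%:R.
  by apply: eq_bigr => j _; rewrite ltn_eqF.
rewrite ltnS leq_eqVlt big_ord_recr/= lamE eqxx => /orP[/eqP ->|sN].
  by rewrite binn mulr1 addrC subrK.
by rewrite hlam// bin_small// mulr0 addr0.
Qed.

Lemma expr_bernoulli (R : realFieldType) (A a : R) b : 0 <= A -> 0 <= a ->
  A ^+ b.+1 + b.+1%:R * a * A ^+ b <= (A + a) ^+ b.+1.
Proof.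
move=> A0 a0; elim: b => [|b ih].
  by rewrite !expr1 expr0 mulr1 mul1r.
have h1 : (A + a) * (A ^+ b.+1 + b.+1%:R * a * A ^+ b) <= (A + a) ^+ b.+2.
  by rewrite [leRHS]exprS ler_wpM2l// addr_ge0.
apply: le_trans h1; rewrite -subr_ge0.
rewrite (_ : _ - _ = a * (b.+1%:R * a * A ^+ b)); last first.
  by rewrite -[in b.+2%:R]natr1 !exprS; ring.
by rewrite !mulr_ge0 ?exprn_ge0.
Qed.

Section binomial_sums.
Variables (R : realFieldType) (x : R) (lam : nat -> R) (N S a : nat).
Hypotheses (x0 : 0 < x) (x1 : x <= 1).
(** By Pascal's rule [H e] is the e-fold sum of [H 0]. Later [e] is the number of elements that a
    support lacks to have maximal size. *)
Let H e u := \sum_(j < N) lam j * 'C(u, j + e)%:R.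
Hypothesis H0 : forall s, (s < N)%N ->
  \sum_(j < N) lam j * 'C(s, j)%:R = ((s <= S)%N * 'C(s, a))%:R.

Let HS e u : H e.+1 u.+1 = H e.+1 u + H e u.
Proof.
rewrite /H -big_split/=; apply: eq_bigr => j _.
by rewrite addnS binS natrD mulrDr.
Qed.

Let HS0 e : H e.+1 0 = 0.
Proof. by rewrite /H big1// => j _; rewrite addnS bin0n mulr0. Qed.

Let H0E u : (u < N)%N -> H 0 u = ((u <= S)%N * 'C(u, a))%:R.
Proof. by move=> uN; rewrite -H0//; apply: eq_bigr => j _; rewrite addn0. Qed.

(** Up to the cut-off, which moves by one with each summation, this is the hockey-stick identity;
    beyond it only nonnegativity is claimed. *)
Lemma binomial_sum_ge e u : (u < N + e)%N ->
  ((u <= S + e)%N * 'C(u, a + e))%:R <= \sum_(j < N) lam j * 'C(u, j + e)%:R.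
Proof.
rewrite -/(H e u); elim: e u => [|e ihe] u.
  by rewrite !addn0 => uN; rewrite H0E.
elim: u => [|u ihu] uN; first by rewrite HS0 bin_small ?muln0 ?addnS.
rewrite HS; rewrite !addnS in uN.
have h1 : (u < N + e.+1)%N by rewrite addnS; lia.
have h2 : (u < N + e)%N by lia.
apply: le_trans (lerD (ihu h1) (ihe _ h2)).
rewrite -natrD ler_nat !addnS ltnS binS.
case: (leqP u (S + e)) => us; last by rewrite mul0n.
by rewrite leqW// !mul1n addnC.
Qed.

Let A u := \sum_(s < u) (if (s <= S)%N then 1 else x).

Let A_ge0 u : 0 <= A u.
Proof. by apply: sumr_ge0 => s _; case: ifP => // _; exact: ltW. Qed.

Let AS u : A u.+1 = A u + (if (u <= S)%N then 1 else x).
Proof. by rewrite /A big_ord_recr. Qed.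

Let A_small u : (u <= S.+1)%N -> A u = u%:R.
Proof.
move=> uS; rewrite /A (eq_bigr (fun=> 1)) ?sumr_const ?card_ord// => s _.
by rewrite (_ : (s <= S)%N)//; have := ltn_ord s; lia.
Qed.

Let A_large v : A (S.+1 + v)%N = (S.+1)%:R + v%:R * x.
Proof.
elim: v => [|v ih]; first by rewrite addn0 mul0r addr0 A_small.
have -> : (S.+1 + v.+1 = (S.+1 + v).+1)%N by rewrite addnS.
rewrite AS ih ifF; last by apply/negbTE; rewrite -ltnNge leq_addr.
by rewrite -[v.+1%:R]natr1 mulrDl mul1r addrA.
Qed.

(** Discrete form of integrating [A ^+ p / p!]. Increments of [A] are at least [x], so a summation
    costs a factor [x]; the first is free because [H 0] vanishes beyond [S] and [A] has slope 1
    before. *)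
Lemma binomial_sum_le e u : (u < N + e.+1)%N ->
  (\sum_(j < N) lam j * 'C(u, j + e.+1)%:R) * x ^+ e * (a + e.+1)`!%:R
    <= A u ^+ (a + e.+1).
Proof.
rewrite -/(H e.+1 u); elim: e u => [|e ihe] u.
  elim: u => [|u ihu] uN.
    by rewrite HS0 !mul0r exprn_ge0.
  rewrite HS expr0 mulr1 mulrDl.
  have h1 : (u < N + 1)%N by lia.
  have := ihu h1; rewrite expr0 mulr1 => {}ihu.
  rewrite H0E; last by lia.
  rewrite addn1 AS; rewrite addn1 in ihu.
  case: (leqP u S) => uS; last first.
    rewrite mul0n mul0r addr0 (le_trans ihu)// lerXn2r ?nnegrE ?addr_ge0//.
      exact: ltW.
    by rewrite lerDl ltW.
  apply: le_trans (expr_bernoulli a (A_ge0 u) ler01).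
  rewrite mul1n lerD// mulr1 factS natrM mulrCA mulrC [leRHS]mulrC ler_wpM2r//.
  rewrite A_small ?leqW// -natrM bin_ffact -natrX ler_nat.
  elim: (a) => // b; rewrite ffactnSr expnSr => h.
  by rewrite leq_mul// leq_subr.
elim: u => [|u ihu] uN.
  by rewrite HS0 !mul0r exprn_ge0.
rewrite HS !mulrDl.
have h1 : (u < N + e.+2)%N by lia.
have h2 : (u < N + e.+1)%N by lia.
have := ihe u h2; have := ihu h1 => {}ihu {}ihe.
have xA : x <= if (u <= S)%N then 1 else x by case: ifP.
have A1 : A u + x <= A u.+1 by rewrite AS lerD2l.
apply: (@le_trans _ _ ((A u + x) ^+ (a + e.+2))); last first.
  by rewrite lerXn2r ?nnegrE ?addr_ge0// ltW.
rewrite addnS; apply: le_trans (expr_bernoulli _ (A_ge0 u) (ltW x0)).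
rewrite -addnS lerD// addnS factS natrM exprS.
rewrite (_ : _ * _ = (a + e.+1).+1%:R * x *
  (H e.+1 u * x ^+ e * ((a + e.+1)`!)%:R)); last by ring.
by rewrite ler_wpM2l// mulr_ge0// ltW.
Qed.

Lemma binomial_sum_le_large e u : (S < u)%N -> (u < N + e.+1)%N ->
  (\sum_(j < N) lam j * 'C(u, j + e.+1)%:R) * x ^+ e * (a + e.+1)`!%:R
    <= (u%:R - (1 - x) * (u - S.+1)%:R) ^+ (a + e.+1).
Proof.
move=> Su uN; apply: le_trans (binomial_sum_le uN) _.
have -> : u = (S.+1 + (u - S.+1))%N by rewrite subnKC.
rewrite A_large addKn [in leRHS]natrD.
by rewrite (_ : _ + _ - _ = S.+1%:R + (u - S.+1)%:R * x)//; ring.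
Qed.

End binomial_sums.

Lemma card_interval_draws (T : finType) (B U : {set T}) r : B \subset U ->
  (#|B| <= r)%N ->
  #|[set Y : {set T} | [&& B \subset Y, Y \subset U & #|Y| == r]]|
    = 'C(#|U| - #|B|, r - #|B|).
Proof.
move=> BU Br; rewrite -(cardsDS BU) -cards_draws.
rewrite -[LHS](@card_in_imset _ _ (fun Y : {set T} => Y :\: B)); last first.
  move=> Y Z; rewrite !inE => /and3P[BY _ _] /and3P[BZ _ _] YZ.
  by rewrite -(finset.setID Y B) -(finset.setID Z B) YZ (finset.setIidPr BY) (finset.setIidPr BZ).
apply: eq_card => Y; apply/imsetP/idP => [[Z]|].
  rewrite !inE => /and3P[BZ ZU /eqP Zr] ->; rewrite finset.setSD//=.
  by rewrite (cardsDS BZ) Zr.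
rewrite inE => /andP[YU /eqP Yr].
have YB : B :&: Y = finset.set0.
  apply/eqP; rewrite finset.setI_eq0 fintype.disjoint_sym finset.disjoints_subset.
  by rewrite (fintype.subset_trans YU)// finset.setDE finset.subsetIr.
exists (B :|: Y).
  rewrite finset.in_set finset.subsetUl finset.subUset BU/=.
  rewrite (fintype.subset_trans YU) ?finset.subsetDl//=.
  by rewrite cardsU YB cards0 subn0 Yr subnKC.
rewrite finset.setDUl finset.setDv finset.set0U.
by apply/esym/finset.setDidPl; rewrite fintype.disjoint_sym -finset.setI_eq0 YB.
Qed.

Section interval_partition.
Variables (R : realFieldType) (n d m k : nat).
Variables (C U : {set 'I_n} -> {set 'I_n}).
Hypothesis Cd : forall Y, (#|C Y| <= d.+1)%N.
Hypothesis CU : forall Y Z,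
  (C Z == C Y) = (C Y \subset Z) && (Z \subset U (C Y)).
Hypotheses (dm : (d < m)%N) (mn : (m <= n)%N) (kn : (k + d.+1 <= n)%N).

Let C_sub Y : C Y \subset Y.
Proof. by have := CU Y Y; rewrite eqxx => /esym/andP[]. Qed.

Let sub_U (Y : {set _}) : Y \subset U (C Y).
Proof. by have := CU Y Y; rewrite eqxx => /esym/andP[]. Qed.

Let card_C_U Y : (#|C Y| <= #|U (C Y)| <= n)%N.
Proof.
rewrite fintype.subset_leq_card ?(fintype.subset_trans (C_sub Y))//=.
by rewrite -[X in (_ <= X)%N]card_ord max_card.
Qed.

Let card_fiber B r : B \in C @: [set: {set 'I_n}] -> (d < r)%N ->
  #|[set Y | (C Y == B) && (#|Y| == r)]| = 'C(#|U B| - #|B|, r - #|B|).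
Proof.
move=> /imsetP[Y _ ->] dr; rewrite -card_interval_draws; last 2 first.
- exact: fintype.subset_trans (C_sub Y) (sub_U Y).
- exact: leq_trans (Cd _) dr.
by apply: eq_card => Z; rewrite !inE CU andbA.
Qed.

Let sum_fiber (P : pred {set 'I_n}) r : (d < r)%N ->
  #|[set Y | P (C Y) && (#|Y| == r)]| =
  (\sum_(B in C @: [set: {set 'I_n}] | P B) 'C(#|U B| - #|B|, r - #|B|))%N.
Proof.
move=> dr; rewrite -sum1_card.
rewrite (partition_big C [pred B in C @: [set: {set 'I_n}] | P B])/=; last first.
  by move=> Y; rewrite inE => /andP[PY _]; rewrite imset_f.
apply: eq_bigr => B /andP[BC PB]; rewrite -card_fiber// -sum1_card.
apply: eq_bigl => Y; rewrite !inE andbC andbA [RHS]andbC.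
by case: (eqVneq (C Y) B) => [->|]; rewrite ?andbF// PB !andbT.
Qed.

(* The identities [sum_fiber] for all [r > d] are combined with weights [lam]
   chosen so that the term of a basis of maximal size [d.+1] is exactly the
   number of [m]-sets with this basis, if it has at least [k] violators. *)
Lemma card_many_violators (x : R) : 0 < x -> x <= 1 ->
  #|[set Y : {set 'I_n} | (#|U (C Y)| + k <= n)%N && (#|Y| == m)]|%:R
    * x ^+ d * m`!%:R <= (n%:R - (1 - x) * (k + d)%:R) ^+ m.
Proof.
(* [N] lets [j + d.+1] run through the cardinalities from [d.+1] to [n]. With this [S], the cut-off
   [S + (d.+1 - #|B|)] on [#|U B| - #|B|] says exactly that [#|U B| + k <= n]. *)
move=> x0 x1; pose N := (n - d)%N; pose S := (n - k - d.+1)%N.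
pose a := (m - d.+1)%N.
have [lam hlam] := @exists_binomial_transform R
  (fun s => ((s <= S)%N * 'C(s, a))%:R) N.
have := @binomial_sum_le_large R x lam N S a x0 x1 hlam d n.
have -> : (a + d.+1 = m)%N by rewrite /a; lia.
have -> : (n - S.+1 = k + d)%N by rewrite /S; lia.
move=> /(_ ltac:(rewrite /S; lia) ltac:(rewrite /N; lia)).
apply: le_trans; rewrite ler_wpM2r// ler_wpM2r ?exprn_ge0 ?(ltW x0)//.
have -> : \sum_(j < N) lam j * 'C(n, j + d.+1)%:R =
  \sum_(B in C @: [set: {set 'I_n}])
    \sum_(j < N) lam j * 'C(#|U B| - #|B|, j + (d.+1 - #|B|))%:R.
  rewrite exchange_big/=; apply: eq_bigr => j _; rewrite -mulr_sumr.
  congr (_ * _); rewrite -[in LHS](card_ord n) -cardsT -cards_draws.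
  transitivity ((#|[set Y | xpredT (C Y) && (#|Y| == (j + d.+1)%N)]|)%:R : R).
    by congr (_%:R); apply: eq_card => Y; rewrite !inE finset.subsetT.
  rewrite (sum_fiber xpredT); last by lia.
  rewrite natr_sum; apply: eq_big => [B|B]; first by rewrite andbT.
  by move=> /andP[/imsetP[Y _ ->] _]; rewrite addnBA.
have := sum_fiber (fun B => (#|U B| + k <= n)%N) dm => ->.
rewrite natr_sum [leRHS](bigID (fun B => (#|U B| + k <= n)%N))/=.
(* The remaining supports contribute a nonnegative amount, by the same lower bound. *)
rewrite -[leLHS]addr0; apply: lerD; last first.
  apply: sumr_ge0 => B /andP[/imsetP[Y _ ->] _].
  have := @binomial_sum_ge R x lam N S a x0 x1 hlam (d.+1 - #|C Y|) (#|U (C Y)| - #|C Y|).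
  move=> h; apply: le_trans (h _); first exact: ler0n.
  by have := Cd Y; have := card_C_U Y; rewrite /N; lia.
apply: ler_sum => B /andP[/imsetP[Y _ ->] hB].
have h1 := Cd Y; have h2 := card_C_U Y.
apply: (le_trans _ (binomial_sum_ge x0 x1 hlam _)); last by rewrite /N; lia.
rewrite (_ : (_ - _ <= _)%N); last by rewrite /S; lia.
rewrite mul1n ler_nat (_ : (a + _ = m - #|C Y|)%N)//.
by rewrite addnBA// subnK.
Qed.

End interval_partition.

(** * Convex programs with lexicographic objectives *)

Local Open Scope classical_set_scope.

Section lexicographic_order.
Context {R : realType} {T : Type}.
Implicit Types (fs : seq (T -> R)) (x y z : T).

Fixpoint lexlt fs x y : bool :=
  if fs is f :: fs' then (f x < f y) || (f x == f y) && lexlt fs' x y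
  else false.

Lemma lexminP fs (X : set T) z :
  lexmin fs X z <-> X z /\ forall x, X x -> ~~ lexlt fs x z.
Proof.
elim: fs X => [|f fs ih] X /=; first by split=> [|[]].
split=> [/ih[[Xz fz] h]|[Xz h]].
  split=> // x Xx; rewrite negb_or -leNgt fz//=; apply/nandP.
  have [fxz|] := eqVneq; [right|by left].
  by apply: h; split=> // x' Xx'; rewrite fxz fz.
have fz x : X x -> f z <= f x.
  by move=> /h; rewrite negb_or -leNgt => /andP[].
apply/ih; split=> // x [Xx fx]; have := h _ Xx.
by rewrite negb_or => /andP[_]; rewrite (_ : f x == f z) ?eq_le ?fz ?fx.
Qed.

Lemma lexlt_irr fs x : lexlt fs x x = false.
Proof. by elim: fs => //= f fs ->; rewrite ltxx andbF. Qed.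

Lemma lexlt_trans fs : transitive (lexlt fs).
Proof.
elim: fs => // f fs ih y x z /=.
move=> /orP[xy|/andP[/eqP xy ltxy]] /orP[yz|/andP[/eqP yz ltyz]].
- by rewrite (lt_trans xy yz).
- by rewrite -yz xy.
- by rewrite xy yz.
- by rewrite xy yz eqxx (ih _ _ _ ltxy ltyz) orbT.
Qed.

Lemma lexlt_antisym fs x y f : ~~ lexlt fs x y -> ~~ lexlt fs y x ->
  f \in fs -> f x = f y.
Proof.
elim: fs => // g fs ih /=; rewrite !negb_or -!leNgt => /andP[yx nxy] /andP[xy nyx].
have gxy : g x = g y by apply/eqP; rewrite eq_le xy yx.
rewrite gxy eqxx/= in nxy nyx.
by rewrite in_cons => /orP[/eqP ->//|]; exact: ih.
Qed.

End lexicographic_order.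

Section lexicographic_minimum.
Context {R : realType} {T : topologicalType}.

(** Minimising one objective over a compact set leaves a closed, hence compact, set for the next
    one. *)
Lemma lexmin_neq0 (fs : seq (T -> R)) (X : set T) :
  (forall f, f \in fs -> continuous f) -> compact X -> X !=set0 ->
  lexmin fs X !=set0.
Proof.
elim: fs X => [|f fs ih] X cfs cX X0 //=.
have cf : continuous f by apply: cfs; rewrite mem_head.
have [z /set_mem Xz fz] := compact_EVT_min X0 cX (continuous_subspaceT cf).
apply: ih => [g gfs||].
- by apply: cfs; rewrite in_cons gfs orbT.
- rewrite (_ : [set _ | _] = X `&` [set x | f x <= f z]).
    apply: compact_closedI => //; rewrite (_ : [set _ | _] = f @^-1` [set u | u <= f z])//.
    by apply: (preimage_closed _ (@closed_le _ (f z))) => y _; exact: cf.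
  apply/seteqP; split=> x [Xx fx]; split=> //; first exact: fx.
  by move=> x' Xx'; apply: (le_trans fx); apply: fz; exact/mem_set.
- by exists z; split=> // x Xx; apply: fz; exact/mem_set.
Qed.

End lexicographic_minimum.

Section convexity.
Context {R : realType} {E : lmodType R}.

Definition cvx_fun (f : E -> R) := forall (x y : E) (t : R), 0 <= t <= 1 ->
  f (t *: x + (1 - t) *: y) <= t * f x + (1 - t) * f y.

Definition cvx_set (X : set E) := forall (x y : E) (t : R), 0 <= t <= 1 ->
  X x -> X y -> X (t *: x + (1 - t) *: y).

Lemma cvx_sublevel f c : cvx_fun f -> cvx_set [set x | f x <= c].
Proof.
move=> cf x y t /[dup] /cf h /andP[t0 t1] /= fx fy.
apply: (le_trans (h _ _)).
rewrite (_ : c = t * c + (1 - t) * c); last by ring.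
by rewrite lerD// ler_wpM2l// subr_ge0.
Qed.

(** At the first objective where [x] or [y] differs from [z], convexity gives a strict gain; as long
    as all three are tied, the mixture is tied or already better. *)
Lemma lexlt_conv (fs : seq (E -> R)) x y z t :
  (forall f, f \in fs -> cvx_fun f) -> 0 < t <= 1 ->
  lexlt fs x z -> ~~ lexlt fs z y -> lexlt fs (t *: x + (1 - t) *: y) z.
Proof.
move=> cfs /andP[t0]; rewrite le_eqVlt => /orP[/eqP ->|t1 +].
  by rewrite subrr scale1r scale0r addr0.
elim: fs cfs => //= f fs ih cfs.
have cf : cvx_fun f by apply: cfs; rewrite mem_head.
have {}ih : lexlt fs x z -> ~~ lexlt fs z y ->
    lexlt fs (t *: x + (1 - t) *: y) z.
  by apply: ih => g gfs; apply: cfs; rewrite in_cons gfs orbT.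
rewrite negb_or -leNgt => fxz /andP[fyz nyz].
have fc := cf x y t; rewrite (ltW t0) (ltW t1) in fc; have {}fc := fc isT.
have [fxz'|fxz'] := ltP (f x) (f z).
  by apply/orP; left; apply: (le_lt_trans fc); nra.
move: fxz; rewrite ltNge fxz'/= => /andP[/eqP fxz xz].
have [fyz'|fyz'] := ltP (f y) (f z).
  by apply/orP; left; apply: (le_lt_trans fc); nra.
have fyE : f y = f z by apply/eqP; rewrite eq_le fyz.
have fcz : f (t *: x + (1 - t) *: y) <= f z.
  by apply: (le_trans fc); rewrite fxz fyE; nra.
move: fcz; rewrite le_eqVlt => /orP[/eqP fcz|->//].
by rewrite fcz eqxx ltxx/= ih//; move: nyz; rewrite fyE eqxx.
Qed.

Lemma cvx_lexlt fs z : (forall f, f \in fs -> cvx_fun f) ->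
  cvx_set [set x | lexlt fs x z].
Proof.
move=> cfs x y t /andP[+ t1] /= xz yz; rewrite le_eqVlt => /orP[/eqP <-|t0].
  by rewrite scale0r add0r subr0 scale1r.
apply: lexlt_conv => //; first by rewrite t0.
by apply/negP => zy; have := lexlt_trans yz zy; rewrite lexlt_irr.
Qed.

Lemma cvx_set_sum (X : set E) (I : finType) (J : pred I) (c : I -> R)
    (p : I -> E) : cvx_set X -> (forall i, J i -> 0 < c i) ->
  (forall i, J i -> X (p i)) -> (exists i, J i) ->
  X ((\sum_(i | J i) c i)^-1 *: \sum_(i | J i) c i *: p i).
Proof.
move=> cX c0 Xp [i Ji].
(* The invariant has a separate case for the empty sum, which cannot be normalised. *)
pose Q (a : R) (v : E) := a = 0 /\ v = 0 \/ 0 < a /\ X (a^-1 *: v).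
have : Q (\sum_(i | J i) c i) (\sum_(i | J i) c i *: p i).
  apply: (big_ind2 Q); [by left| |].
    move=> a u b v [[-> ->]|[a0 Xa]] [[-> ->]|[b0 Xb]].
    - by rewrite !addr0; left.
    - by rewrite !add0r; right.
    - by rewrite !addr0; right.
    - right; split; first exact: addr_gt0.
      have ab : 0 < a + b by exact: addr_gt0.
      have := cX _ _ (a / (a + b)) _ Xa Xb.
      have -> : 1 - a / (a + b) = b / (a + b) by field; rewrite gt_eqF.
      rewrite !scalerA ![_ / (a + b)]mulrC -!mulrA !divff ?gt_eqF// !mulr1 -scalerDr.
      apply; rewrite mulr_ge0 ?invr_ge0 ?(ltW a0) ?(ltW ab)//=.
      by rewrite mulrC ler_pdivrMr// mul1r lerDl ltW.
  move=> j Jj; right; split; first exact: c0.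
  by rewrite scalerA mulVf ?scale1r ?gt_eqF ?c0//; exact: Xp.
case=> [[s0 _]|[_ //]].
suff : 0 < \sum_(i | J i) c i by rewrite s0 ltxx.
by rewrite (bigD1 i)//= ltr_pwDl ?c0// sumr_ge0// => j /andP[Jj _]; rewrite ltW ?c0.
Qed.

End convexity.

(** * Radon's theorem *)

Section radon.
Context {R : realType} {E : lmodType R} {d : nat} (coord : 'I_d -> E -> R).

(** Dimension at most [d], expressed by [d] jointly injective linear functionals. *)
Definition coordinates :=
  (forall i a x y, coord i (a *: x + y) = a * coord i x + coord i y) /\
  (forall x y, (forall i, coord i x = coord i y) -> x = y).

Hypothesis hcoord : coordinates.

Lemma coord0 i : coord i 0 = 0.
Proof. by have := hcoord.1 i (-1) 0 0; rewrite scaler0 addr0 mulN1r addNr. Qed.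

Lemma coord_sum i (I : finType) (c : I -> R) (p : I -> E) :
  coord i (\sum_j c j *: p j) = \sum_j c j * coord i (p j).
Proof.
elim: (index_enum I) => [|j s ih]; first by rewrite !big_nil coord0.
by rewrite !big_cons hcoord.1 ih.
Qed.

(** The coordinates of the points with a column of ones appended form a matrix of rank at most
    [d.+1], so its left kernel contains a nonzero vector, which is an affine dependence. Its entries
    sum to 0, so one of them is positive. *)
Lemma radon (I : finType) (p : I -> E) : (d.+1 < #|I|)%N ->
  exists c : I -> R,
    [/\ \sum_i c i = 0, \sum_i c i *: p i = 0 & exists i, 0 < c i].
Proof.
move=> dI.
pose X := \matrix_(i < #|I|, j < d) coord j (p (enum_val i)).
pose M := row_mx X (const_mx 1 : 'cV[R]_#|I|).
have /rowV0Pn[v /sub_kermxP vM v0] : kermx M != 0.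
  rewrite -mxrank_eq0 mxrank_ker subn_eq0 -ltnNge.
  by rewrite (leq_ltn_trans (rank_leq_col M))// addn1.
move: vM; rewrite mul_mx_row -[0]row_mx0 => /eq_row_mx[vX v1].
have sumE (g : I -> R) :
    \sum_i v 0 (enum_rank i) * g i = \sum_j v 0 j * g (enum_val j).
  rewrite (reindex (@enum_val I predT))/=.
    by apply: eq_bigr => j _; rewrite enum_valK.
  by apply: onW_bij; exact: enum_val_bij.
exists (fun i => v 0 (enum_rank i)).
have c0 : \sum_i v 0 (enum_rank i) = 0.
  under eq_bigr => i _ do rewrite -[v _ _]mulr1.
  rewrite (sumE (fun=> 1)).
  have := congr1 (fun A : 'M[R]_1 => A 0 0) v1; rewrite !mxE => {2}<-.
  by apply: eq_bigr => j _; rewrite mxE.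
split=> //.
  apply: hcoord.2 => k; rewrite coord_sum coord0 sumE.
  have := congr1 (fun A : 'rV[R]_d => A 0 k) vX; rewrite !mxE => {2}<-.
  by apply: eq_bigr => j _; rewrite mxE.
apply: contrapT => /forallNP npos; move/eqP: v0; apply.
have h : \sum_i - v 0 (enum_rank i) = 0 by rewrite sumrN c0 oppr0.
have h2 i : 0 <= - v 0 (enum_rank i).
  by rewrite oppr_ge0 leNgt; apply/negP; exact: npos.
have := psumr_eq0P (fun i _ => h2 i) h => {}h.
apply/rowP => j; rewrite mxE -[j]enum_valK.
by have /eqP := h (enum_val j) isT; rewrite oppr_eq0 => /eqP.
Qed.

End radon.

(** * Bases and supports of a convex program *)

Section convex_program.
Context {R : realType} {E : normedModType R} {d : nat} {coord : 'I_d -> E -> R}.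
Hypothesis hcoord : coordinates coord.
Context {n : nat} (fs : seq (E -> R)) (K : set E) (phi : 'I_n -> E -> R)
  (e : 'I_n -> R).

Definition feas (Y : {set 'I_n}) : set E :=
  [set z | K z /\ forall s, s \in Y -> phi s z <= e s].

Definition opt (Y : {set 'I_n}) : E := xget 0 (lexmin fs (feas Y)).

(** The last clause, that the objectives together separate points, makes the lexicographic minimiser
    unique. *)
Definition objectives := [/\ forall f, f \in fs -> cvx_fun f,
  forall f, f \in fs -> continuous f &
  forall x y, (forall f, f \in fs -> f x = f y) -> x = y].

Definition convex_constraints := [/\ compact K, cvx_set K,
  forall s, cvx_fun (phi s) & forall s, continuous (phi s)].

Implicit Types B X Y Z : {set 'I_n}.
Hypotheses (hfs : objectives) (hK : convex_constraints).
Variables (T : {set 'I_n}) (z0 : E).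
Hypotheses (Kz0 : K z0) (Tz0 : forall s, s \in T -> phi s z0 <= e s).

Lemma feas_sub Y Z : Y \subset Z -> feas Z `<=` feas Y.
Proof. by move=> /fintype.subsetP YZ z [Kz h]; split=> // s /YZ; exact: h. Qed.

Lemma compact_feas Y : compact (feas Y).
Proof.
have [cK _ _ cphi] := hK.
rewrite (_ : feas Y = K `&` \bigcap_(s in [set s | s \in Y])
    (phi s @^-1` [set u | u <= e s])).
  apply: compact_closedI => //; apply: closed_bigI => s _.
  by apply: (preimage_closed _ (@closed_le _ (e s))) => x _; exact: cphi.
by apply/seteqP; split=> z [].
Qed.

Lemma lexmin_opt Y : Y \subset T -> lexmin fs (feas Y) (opt Y).
Proof.
move=> YT; apply: xgetPex; apply: lexmin_neq0; first by have [] := hfs.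
  exact: compact_feas.
by exists z0; split=> // s /(fintype.subsetP YT); exact: Tz0.
Qed.

Lemma opt_feas Y : Y \subset T -> feas Y (opt Y).
Proof. by move=> /lexmin_opt/lexminP[]. Qed.

Lemma opt_min Y z : Y \subset T -> feas Y z -> ~~ lexlt fs z (opt Y).
Proof. by move=> /lexmin_opt/lexminP[_]; apply. Qed.

Lemma opt_unique Y z : Y \subset T -> feas Y z ->
  (forall x, feas Y x -> ~~ lexlt fs x z) -> opt Y = z.
Proof.
move=> YT Yz zmin; have [_ _] := hfs; apply => f.
by apply: lexlt_antisym; [exact: zmin (opt_feas YT)|exact: opt_min].
Qed.

Lemma opt_superset Y Z : Y \subset Z -> Z \subset T -> feas Z (opt Y) ->
  opt Z = opt Y.
Proof.
move=> YZ ZT Zy; apply: opt_unique => // x Zx.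
by apply: opt_min; [exact: fintype.subset_trans ZT|exact: feas_sub Zx].
Qed.

Lemma opt_sandwich X Y Z : X \subset Y -> Y \subset Z -> Z \subset T ->
  opt X = opt Z -> opt Y = opt Z.
Proof.
move=> XY YZ ZT XZ; rewrite -XZ; apply: opt_superset => //.
  exact: fintype.subset_trans ZT.
by rewrite XZ; exact: feas_sub (opt_feas ZT).
Qed.

Lemma opt_better Y Z : Y \subset Z -> Z \subset T -> opt Y != opt Z ->
  lexlt fs (opt Y) (opt Z).
Proof.
move=> YZ ZT; apply: contraNT => h; apply/eqP; have [_ _] := hfs; apply => f.
apply: lexlt_antisym => //; apply: opt_min.
  exact: fintype.subset_trans ZT.
exact: feas_sub (opt_feas ZT).
Qed.

(** If the removal of [s] improved the optimum, a short move from [opt Y] towards the better point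
    would keep [s] satisfied, thanks to the slack, and would beat [opt Y]. *)
Lemma opt_remove_slack Y s : Y \subset T -> phi s (opt Y) < e s ->
  opt (Y :\ s) = opt Y.
Proof.
move=> YT slack; apply/eqP; apply: contraT => neq.
have YsY : Y :\ s \subset Y by exact: finset.subsetDl.
have YsT : Y :\ s \subset T by exact: fintype.subset_trans YT.
have better := opt_better YsY YT neq.
have [_ cvxK cvx_phi _] := hK; have [cvx_fs _ _] := hfs.
have [Ky Yy] := opt_feas YT; have [Ky' Yy'] := opt_feas YsT.
set y := opt Y in slack better Ky Yy *; set y' := opt (Y :\ s) in better Ky' Yy' *.
have [t t01 ht] : exists2 t, 0 < t <= 1 &
    t * phi s y' + (1 - t) * phi s y <= e s.
  have [h|h] := leP (phi s y') (e s).
    by exists 1; rewrite ?ltr01//= mul1r subrr mul0r addr0.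
  have h1 : 0 < phi s y' - phi s y by rewrite subr_gt0 (lt_trans slack).
  (* The chord of [phi s] between the two optima reaches the level [e s] here. *)
  exists ((e s - phi s y) / (phi s y' - phi s y)).
    apply/andP; split; first by rewrite divr_gt0// subr_gt0.
    by rewrite ler_pdivrMr// mul1r lerD2r ltW.
  rewrite le_eqVlt; apply/orP; left; apply/eqP; field; exact: lt0r_neq0.
have t01' : 0 <= t <= 1 by case/andP: t01 => /ltW -> ->.
suff : lexlt fs (t *: y' + (1 - t) *: y) y.
  apply: contraTT => _; apply: opt_min => //; split; first exact: cvxK.
  move=> u uY; apply: (le_trans (cvx_phi u _ _ _ t01')).
  have [->//|us] := eqVneq u s.
  have h1 : phi u y' <= e u by apply: Yy'; rewrite !inE us.
  have h2 := Yy _ uY.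
  by case/andP: t01' => t0 t1; nra.
by apply: lexlt_conv => //; rewrite lexlt_irr.
Qed.

(* Radon's theorem is applied to the optima [opt (Y :\ s)] together with
   [opt Y]: the common point of the two convex hulls satisfies all the
   constraints of [Y], and the hull that avoids [opt Y] consists of points
   which are strictly better than [opt Y]. *)
Lemma opt_remove Y : Y \subset T -> (d < #|Y|)%N ->
  exists2 s, s \in Y & opt (Y :\ s) = opt Y.
Proof.
move=> YT dY; apply: contrapT => noS.
have neq s : s \in Y -> opt (Y :\ s) != opt Y.
  by move=> sY; apply/eqP => h; apply: noS; exists s.
pose p (i : option {s : 'I_n | s \in Y}) : E :=
  if i is Some s then opt (Y :\ sval s) else opt Y.
have [|c [c0 cp [i ci]]] := radon hcoord p.
  by rewrite card_option card_sig ltnS.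
have cN : \sum_(i | 0 < c i) c i = \sum_(i | c i < 0) - c i.
  apply/eqP; rewrite -subr_eq0 sumrN opprK -[X in _ == X]c0.
  rewrite [X in _ == X](bigID (fun i => 0 < c i))/=; apply/eqP; congr (_ + _).
  rewrite [RHS](bigID (fun i => c i < 0))/= [X in _ + X]big1 ?addr0.
    by apply: eq_bigl => j; case: ltgtP.
  by move=> j; case: ltgtP.
have cpN : \sum_(i | 0 < c i) c i *: p i = \sum_(i | c i < 0) - c i *: p i.
  apply/eqP; rewrite -subr_eq0 -sumrN -[X in _ == X]cp.
  rewrite [X in _ == X](bigID (fun i => 0 < c i))/=; apply/eqP; congr (_ + _).
  rewrite [RHS](bigID (fun i => c i < 0))/= [X in _ + X]big1 ?addr0.
    by apply: eq_big => [j|j _]; [case: ltgtP|rewrite scaleNr opprK].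
  by move=> j; case: ltgtP => // <-; rewrite scale0r.
have [j cj] : exists j, c j < 0.
  apply: contrapT => /forallNP h.
  have : 0 < \sum_(i | 0 < c i) c i.
    by rewrite (bigD1 i)//= ltr_pwDl// sumr_ge0// => k /andP[/ltW].
  by rewrite cN big_pred0 ?ltxx// => k; apply/negP; exact: h.
have [_ cvxK cvx_phi _] := hK; have [cvx_fs _ _] := hfs.
have p_feas i' s : s \in Y -> (if i' is Some u then sval u != s else true) ->
    phi s (p i') <= e s.
  move=> sY; case: i' => [[u uY]/= us|_]; last by case: (opt_feas YT) => _; apply.
  have [_] := @opt_feas (Y :\ u) (fintype.subset_trans (finset.subsetDl _ _) YT).
  by apply; rewrite !inE eq_sym us.
have pK i' : K (p i').
  case: i' => [[u uY]|]/=; last by case: (opt_feas YT).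
  by case: (@opt_feas (Y :\ u) (fintype.subset_trans (finset.subsetDl _ _) YT)).
have contra (J1 J2 : pred (option {s : 'I_n | s \in Y})) (c1 c2 : _ -> R) x :
    (forall i, J1 i -> 0 < c1 i) -> (forall i, J2 i -> 0 < c2 i) ->
    (exists i, J1 i) -> (exists i, J2 i) -> (forall i, J1 i -> ~~ J2 i) ->
    x = (\sum_(i | J1 i) c1 i)^-1 *: \sum_(i | J1 i) c1 i *: p i ->
    x = (\sum_(i | J2 i) c2 i)^-1 *: \sum_(i | J2 i) c2 i *: p i ->
    ~~ J1 None -> False.
  move=> c10 c20 J10 J20 J12 x1 x2 J1N.
  suff /(opt_min YT)/negP : feas Y x.
    apply; rewrite x1; apply: (cvx_set_sum (cvx_lexlt (z := opt Y) cvx_fs)) => //.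
    case=> [[s sY]/=|] J1s; last by rewrite J1s in J1N.
    by apply: opt_better => //; [exact: finset.subsetDl|exact: neq].
  split; first by rewrite x1; exact: cvx_set_sum.
  (* Only the point [opt (Y :\ s)] may violate [s], and it occurs in at most one of the two hulls;
     the other hull shows that [x] satisfies [s]. *)
  move=> s sY; have [J1s|J1s] := boolP (J1 (Some (exist _ s sY))).
    rewrite x2; apply: (cvx_set_sum (cvx_sublevel (c := e s) (cvx_phi s))) => //=.
    move=> i' J2i'; apply: p_feas => //; case: i' J2i' => [[u uY]|]//= J2u.
    apply: contraTneq J2u => us.
    rewrite (_ : exist _ u uY = exist _ s sY :> {s : 'I_n | s \in Y}) ?J12//.
    exact/val_inj.
  rewrite x1; apply: (cvx_set_sum (cvx_sublevel (c := e s) (cvx_phi s))) => //=.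
  move=> i' J1i'; apply: p_feas => //; case: i' J1i' => [[u uY]|]//= J1u.
  apply: contraNneq J1s => us.
  rewrite (_ : exist _ s sY = exist _ u uY :> {s : 'I_n | s \in Y})//.
  exact/val_inj.
have [cN0|cN0] := boolP (0 < c None).
  apply: (contra (fun i => c i < 0) (fun i => 0 < c i) (fun i => - c i) c
    ((\sum_(i | 0 < c i) c i)^-1 *: \sum_(i | 0 < c i) c i *: p i)) => //.
  - by move=> k; rewrite oppr_gt0.
  - by exists j.
  - by exists i.
  - by move=> k; case: ltgtP.
  - by rewrite cN cpN.
  - by move: cN0; case: ltgtP.
apply: (contra (fun i => 0 < c i) (fun i => c i < 0) c (fun i => - c i)
  ((\sum_(i | 0 < c i) c i)^-1 *: \sum_(i | 0 < c i) c i *: p i)) => //.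
- by move=> k; rewrite oppr_gt0.
- by exists i.
- by exists j.
- by move=> k; case: ltgtP.
- by rewrite cN cpN.
Qed.

Definition support_set Y := [set s in Y | opt (Y :\ s) != opt Y].

Definition satisfied Y := [set s in T | phi s (opt Y) <= e s].

Lemma exists_basis Y : Y \subset T -> exists B : {set 'I_n},
  [/\ B \subset Y, (#|B| <= d)%N, opt B = opt Y &
      forall s, s \in B -> opt (B :\ s) != opt B].
Proof.
move=> YT; pose P (B : {set 'I_n}) := (B \subset Y) && (opt B == opt Y).
have [|B /minsetP[/andP[BY /eqP BYo] Bmin]] := @ex_minset _ P.
  by exists Y; rewrite /P fintype.subxx eqxx.
have neq s : s \in B -> opt (B :\ s) != opt B.
  move=> sB; apply: contraTneq sB => h.
  have <- : B :\ s = B.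
    apply: Bmin; last exact: finset.subsetDl.
    by rewrite /P h BYo eqxx (fintype.subset_trans (finset.subsetDl _ _) BY).
  by rewrite !inE eqxx.
exists B; split=> //; rewrite leqNgt; apply/negP => dB.
have [s sB h] := opt_remove (fintype.subset_trans BY YT) dB.
by have := neq s sB; rewrite h eqxx.
Qed.

Hypothesis generic : forall X s, s \notin X -> phi s (opt X) != e s.

Lemma strict_unless_support Y s : Y \subset T -> s \in Y ->
  opt (Y :\ s) = opt Y -> phi s (opt Y) < e s.
Proof.
move=> YT sY h; rewrite lt_neqAle -h generic ?inE ?eqxx//= h.
by case: (opt_feas YT) => _; apply.
Qed.

(** Uniqueness of the basis. In generic position a constraint that can be removed from [Y] is slack
    at the common optimum, so it could be removed from [B] as well; a constraint outside [B] is
    removable by the sandwich [B], [Y :\ s], [Y]. *)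
Lemma basis_support B Y : B \subset Y -> Y \subset T -> opt B = opt Y ->
  (forall s, s \in B -> opt (B :\ s) != opt B) -> support_set Y = B.
Proof.
move=> BY YT BYo Bmin; apply/setP => s; rewrite inE.
have [sB|sB] := boolP (s \in B).
  rewrite (fintype.subsetP BY)//=; apply: contra (Bmin s sB) => /eqP h.
  have := strict_unless_support YT (fintype.subsetP BY s sB) h.
  by rewrite -BYo => /opt_remove_slack ->//; exact: fintype.subset_trans YT.
apply/negbTE/nandP; have [sY|] := boolP (s \in Y); [right|by left].
apply/negPn/eqP/(opt_sandwich _ _ _ BYo) => //; last exact: finset.subsetDl.
by apply/fintype.subsetP => u uB; rewrite !inE (fintype.subsetP BY)// andbT;
   apply: contraNneq sB => <-.
Qed.

Lemma card_support Y : Y \subset T -> (#|support_set Y| <= d)%N.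
Proof.
by move=> YT; have [B [BY Bd BYo Bmin]] := exists_basis YT; rewrite (basis_support BY).
Qed.

Lemma opt_support Y : Y \subset T -> opt (support_set Y) = opt Y.
Proof.
by move=> YT; have [B [BY Bd BYo Bmin]] := exists_basis YT; rewrite (basis_support BY).
Qed.

(** Adding to a support constraints that its optimum satisfies changes neither the optimum nor, by
    uniqueness, the basis. *)
Lemma support_setE Y Z : Y \subset T -> Z \subset T ->
  (support_set Z == support_set Y) =
  (support_set Y \subset Z) && (Z \subset satisfied (support_set Y)).
Proof.
move=> YT ZT; apply/eqP/andP => [ZY|[YZ ZY]].
  split; first by rewrite -ZY; apply/fintype.subsetP => s; rewrite inE => /andP[].
  rewrite -ZY; apply/fintype.subsetP => s sZ; rewrite inE (fintype.subsetP ZT)//=.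
  by rewrite opt_support//; case: (opt_feas ZT) => _; apply.
apply: basis_support => //.
  symmetry; apply: opt_superset => //; split.
    by rewrite opt_support//; case: (opt_feas YT).
  by move=> s /(fintype.subsetP ZY); rewrite inE => /andP[].
have [B [BY Bd BYo Bmin]] := exists_basis YT.
by rewrite (basis_support BY).
Qed.

End convex_program.

(* Counting on a grid: if [s] is not in [Y], changing the coordinate [s] of [e]
   alone, at most one value satisfies the forbidden equation. *)
Lemma exists_generic (R : realFieldType) n
    (F : ('I_n -> R) -> {set 'I_n} -> 'I_n -> R) (kappa : R) : 0 < kappa ->
  (forall e e' (Y : {set 'I_n}) s, (forall i, i \in Y -> e i = e' i) -> F e Y s = F e' Y s) ->
  exists e : 'I_n -> R, (forall s, 0 < e s <= kappa) /\
    forall (Y : {set 'I_n}) s, s \notin Y -> F e Y s != e s.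
Proof.
(* Each pair [(Y, s)] excludes at most a fraction 1/M of the grid, and there are only M - 1
   pairs. *)
move=> kappa0 Floc; pose M := (#|{: {set 'I_n} * 'I_n}|).+1.
pose e (a : {ffun 'I_n -> 'I_M}) s : R := kappa * (a s).+1%:R / M%:R.
pose bad (Ys : {set 'I_n} * 'I_n) (a : {ffun 'I_n -> 'I_M}) :=
  (Ys.2 \notin Ys.1) && (F (e a) Ys.1 Ys.2 == e a Ys.2).
have e_inj a b s : e a s = e b s -> a s = b s.
  have c0 : kappa / M%:R != 0 by rewrite mulf_neq0 ?gt_eqF ?invr_gt0.
  rewrite /e ![kappa * _ / _]mulrAC => /(mulfI c0)/eqP.
  by rewrite eqr_nat eqSS => /eqP/val_inj.
have bad_card Ys : (#|[pred a | bad Ys a]| * M <= M ^ n)%N.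
  case: Ys => Y s.
  rewrite -[X in (_ * X)%N]card_ord -cardX.
  rewrite -[X in (_ <= X ^ _)%N]card_ord -[X in (_ <= _ ^ X)%N](card_ord n) -card_ffun.
  pose f (ai : {ffun 'I_n -> 'I_M} * 'I_M) : {ffun 'I_n -> 'I_M} :=
    [ffun u => if u == s then ai.2 else ai.1 u].
  rewrite -(@card_in_imset _ _ f); first exact: max_card.
  move=> [a i] [b j]; rewrite !inE/= => /andP[/andP[sY Fa] _] /andP[/andP[_ Fb] _].
  move=> /ffunP fab; have := fab s; rewrite !ffunE eqxx/= => ->; congr (_, _).
  have ab u : u != s -> a u = b u.
    by move=> us; have := fab u; rewrite !ffunE (negbTE us).
  apply/ffunP => u; have [->|/ab//] := eqVneq u s.
  apply: e_inj; rewrite -(eqP Fa) -(eqP Fb); apply: Floc => i' i'Y.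
  by rewrite /e ab//; apply: contraNneq sY => <-.
have [a good] : exists a, forall Ys, ~~ bad Ys a.
  apply: contrapT => /forallNP allbad.
  have h1 : (M ^ n <= \sum_Ys #|[pred a | bad Ys a]|)%N.
    rewrite -[X in (X ^ _ <= _)%N]card_ord -[X in (_ ^ X <= _)%N](card_ord n) -card_ffun.
    rewrite (eq_bigr (fun Ys => \sum_a (bad Ys a : nat))%N); last first.
      by move=> Ys _; rewrite -sum1_card big_mkcond/=;
         apply: eq_bigr => a _; rewrite inE; case: ifP.
    rewrite exchange_big/= -sum1_card; apply: leq_sum => a _.
    have /existsNP[Ys /negP] := allbad a; rewrite negbK => h.
    by rewrite (bigD1 Ys)//= h.
  have : (M ^ n * M <= M.-1 * M ^ n)%N.
    apply: (leq_trans (leq_mul h1 (leqnn M))); rewrite big_distrl/=.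
    by apply: (leq_trans (leq_sum _ (fun Ys _ => bad_card Ys))); rewrite sum_nat_const.
  by rewrite mulnC leq_pmul2r ?expn_gt0// /M /= ltnn.
exists (e a); split=> [s|Y s sY].
  rewrite /e divr_gt0 ?mulr_gt0//= ler_pdivrMr// ler_wpM2l ?(ltW kappa0)//.
  by rewrite ler_nat.
by have := good (Y, s); rewrite /bad/= sY.
Qed.

(** * Perturbation to a nondegenerate program *)

Section hull_distance.
Context {R : realType} {E : normedModType R}.

Lemma exists_compact_hull (p : E) (ps : seq E) : exists L : set E,
  [/\ compact L, cvx_set L, forall q, q \in p :: ps -> L q &
      forall A, cvx_set A -> (forall q, q \in p :: ps -> A q) -> L `<=` A].
Proof.
elim: ps p => [|p' ps ih] p.
  exists [set p]; split; first exact: compact_set1.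
  - by move=> x y t t01 /= -> ->; rewrite -scalerDl addrC subrK scale1r.
  - by move=> q; rewrite inE => /eqP.
  - by move=> A _ h q /= ->; apply: h; rewrite mem_head.
have [L [cL cvxL Lps minL]] := ih p'.
pose f (tl : R * E) := tl.1 *: p + (1 - tl.1) *: tl.2.
exists (f @` ([set t | 0 <= t <= 1] `*` L)); split.
- apply: continuous_compact.
    apply: continuous_subspaceT => tl.
    apply: cvgD; first by apply: cvgZr_tmp; exact: cvg_fst.
    by apply: cvgZ; [apply: cvgB; [exact: cvg_cst|exact: cvg_fst]|exact: cvg_snd].
  apply: compact_setX => //.
  have -> : [set t : R | 0 <= t <= 1] = `[0, 1]%classic.
    by apply/seteqP; split=> t /=; rewrite in_itv.
  exact: segment_compact.
- move=> _ _ s s01 [[t l] [/= t01 Ll] <-] [[t' l'] [/= t01' Ll'] <-].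
  (* The weight of [p] in the mixture; the points of [L] are recombined with denominator [1 - tau],
     so [tau = 1] is a separate case. *)
  pose tau := s * t + (1 - s) * t'.
  have tau01 : 0 <= tau <= 1 by rewrite /tau; nra.
  have [tau1|tau1] := eqVneq tau 1.
    have h1 : s * (1 - t) = 0 by rewrite /tau in tau1; nra.
    have h2 : (1 - s) * (1 - t') = 0 by rewrite /tau in tau1; nra.
    exists (1, l); first by split=> //=; rewrite ler01 lexx.
    rewrite /f/= subrr scale0r addr0 !scalerDr !scalerA h1 h2 !scale0r !addr0.
    by rewrite -scalerDl -/tau tau1.
  have tau0 : 0 < 1 - tau by rewrite subr_gt0 lt_neqAle tau1; case/andP: tau01.
  exists (tau, (s * (1 - t) / (1 - tau)) *: l + (1 - s * (1 - t) / (1 - tau)) *: l').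
    split=> //=; apply: cvxL => //; rewrite ler_pdivrMr// mul1r.
    rewrite divr_ge0 ?(ltW tau0)//=; rewrite /tau; nra.
  rewrite /f/= !scalerDr !scalerA addrACA -scalerDl; congr (_ + (_ *: _ + _ *: _)).
    by field; rewrite gt_eqF.
  by rewrite /tau; field; rewrite gt_eqF.
- move=> q; rewrite in_cons => /orP[/eqP ->|/Lps Lq].
    exists (1, p'); first by split=> /=; [rewrite ler01 lexx|apply: Lps; rewrite mem_head].
    by rewrite /f/= subrr scale0r addr0 scale1r.
  exists (0, q); first by split=> //=; rewrite lexx ler01.
  by rewrite /f/= scale0r add0r subr0 scale1r.
- move=> A cA Aps _ [[t l] [/= t01 Ll] <-]; apply: (cA _ _ _ t01).
    by apply: Aps; rewrite mem_head.
  by apply: (minL A cA) Ll => q qps; apply: Aps; rewrite in_cons qps orbT.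
Qed.

(** [F] is the distance to the convex hull of [ps], and the constant 1 if [ps] is empty, as then no
    point may have a nonpositive value. The last clause will be applied to the convex set of points
    better than a given one. *)
Lemma exists_hull_gauge (ps : seq E) : exists F : E -> R,
  [/\ cvx_fun F, continuous F, forall q, q \in ps -> F q <= 0 &
      forall A, cvx_set A -> (forall q, q \in ps -> A q) ->
        forall z, F z <= 0 -> A z].
Proof.
case: ps => [|p ps].
  exists (fun=> 1); split=> //.
  - by move=> x y t _; rewrite !mulr1 addrC subrK.
  - by move=> x; exact: cvg_cst.
  - by move=> A _ _ z; rewrite lt_geF.
have [L [cL cvxL Lps minL]] := exists_compact_hull p ps.
have /choice[pr hpr] (z : E) : exists l, L l /\ forall l', L l' -> `|z - l| <= `|z - l'|.
  have [||l /set_mem Ll lmin] := @compact_EVT_min _ _ (fun l => `|z - l|) L _ cL.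
  - by exists p; apply: Lps; rewrite mem_head.
  - apply: continuous_subspaceT => l; apply: cvg_norm.
    by apply: cvgB; [exact: cvg_cst|exact: cvg_id].
  - by exists l; split=> // l' Ll'; apply: lmin; exact/mem_set.
exists (fun z => `|z - pr z|); split.
- move=> x y t t01; have [Lx _] := hpr x; have [Ly _] := hpr y.
  have [_] := hpr (t *: x + (1 - t) *: y).
  move=> /(_ _ (cvxL _ _ _ t01 Lx Ly)) h; apply: (le_trans h).
  rewrite opprD addrACA -!scalerBr; apply: (le_trans (ler_normD _ _)).
  by case/andP: t01 => t0 t1; rewrite !normrZ !ger0_norm ?subr_ge0.
- move=> z; apply/cvgrPdist_le => eps eps0.
  have lip x y : `|x - pr x| - `|y - pr y| <= `|x - y|.
    rewrite lerBlDr; have [_ /(_ _ (hpr y).1) h] := hpr x; apply: (le_trans h).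
    by rewrite -[x - pr y](subrKA y); exact: ler_normD.
  have : \forall x \near z, `|z - x| <= eps.
    by apply/cvgr_dist_le => //; exact: cvg_id.
  apply: filterS => x zx; apply: le_trans zx.
  by rewrite ler_norml lip andbT lerNl opprB [leRHS]distrC; exact: lip.
- move=> q qps; have [_ /(_ q)] := hpr q; rewrite subrr normr0; apply.
  exact: Lps.
- move=> A cA Aps z; rewrite normr_le0 subr_eq0 => /eqP ->.
  by apply: (minL A) => //; case: (hpr z).
Qed.

End hull_distance.

Section bigmax.
Context {R : realType}.

Lemma continuous_bigmax (T : topologicalType) (I : Type) (r : seq I)
    (P : pred I) (f : I -> T -> R) (c : R) : (forall i, continuous (f i)) ->
  continuous (fun z => \big[Num.max/c]_(i <- r | P i) f i z).
Proof.
move=> cf z; elim: r => [|i r ih].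
  by under eq_fun do rewrite big_nil; exact: cvg_cst.
under eq_fun do rewrite big_cons.
by case: (P i) => //; apply: continuous_max => //; exact: cf.
Qed.

Lemma cvx_fun_bigmax (E : lmodType R) (I : finType) (P : pred I) (f : I -> E -> R)
  (c : R) : (forall i, cvx_fun (f i)) ->
  cvx_fun (fun z => \big[Num.max/c]_(i | P i) f i z).
Proof.
move=> cf x y t /[dup] t01 /andP[t0 t1]; apply/bigmax_leP; split=> [|i Pi].
  have h (z : E) : c <= \big[Num.max/c]_(i | P i) f i z by exact: bigmax_ge_id.
  by have := h x; have := h y; nra.
apply: (le_trans (cf i _ _ _ t01)).
by rewrite lerD// ler_wpM2l ?subr_ge0//; exact: le_bigmax_cond.
Qed.

End bigmax.

(** On the compact set where [F <= 0] the largest violation among [Y] has a positive minimum, and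
    half of it is a safe relaxation. As there are finitely many [Y], one [kappa] serves all. *)
Lemma compact_positive_gap {R : realType} {E : topologicalType} (K : set E)
    (I : finType) (phi : I -> E -> R) (F : E -> R) : compact K ->
  (forall i, continuous (phi i)) -> continuous F ->
  exists kappa, 0 < kappa /\ forall Y : {set I},
    (forall z, K z -> (forall s, s \in Y -> phi s z <= 0) -> 0 < F z) ->
    forall z, K z -> (forall s, s \in Y -> phi s z <= kappa) -> 0 < F z.
Proof.
move=> cK cphi cF.
have gap (Y : {set I}) : exists kappa, 0 < kappa /\
    ((forall z, K z -> (forall s, s \in Y -> phi s z <= 0) -> 0 < F z) ->
    forall z, K z -> (forall s, s \in Y -> phi s z <= kappa) -> 0 < F z).
  have [hY|hY] := pselect (forall z, K z ->
      (forall s, s \in Y -> phi s z <= 0) -> 0 < F z); last first.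
    by exists 1; split=> // /hY.
  pose K' := K `&` (F @^-1` [set u | u <= 0]).
  have cK' : compact K'.
    apply: compact_closedI => //.
    by apply: (preimage_closed _ (@closed_le _ 0)) => x _; exact: cF.
  have [K'0|/set0P K'0] := eqVneq K' set0; last first.
    pose g z := \big[Num.max/0]_(s in Y) phi s z.
    have cg : continuous g by exact: continuous_bigmax.
    have [z0 /set_mem[Kz0 Fz0] gmin] :=
      compact_EVT_min K'0 cK' (continuous_subspaceT cg).
    have g0 : 0 < g z0.
      rewrite ltNge; apply/negP => /bigmax_leP[_ h].
      by have := hY _ Kz0 h; rewrite ltNge Fz0.
    exists (g z0 / 2); rewrite divr_gt0//; split=> // _ z Kz hz.
    rewrite ltNge; apply/negP => Fz.
    have := gmin z (mem_set (conj Kz Fz)); apply/negP; rewrite -ltNge.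
    apply: (@le_lt_trans _ _ (g z0 / 2)); last by rewrite ltr_pdivrMr// ltr_pMr// ltr1n.
    by apply/bigmax_leP; split=> //; rewrite divr_ge0// ltW.
  exists 1; split=> // _ z Kz _; rewrite ltNge; apply/negP => Fz.
  by have : set0 z by rewrite -K'0.
have /choice[k hk] := gap.
exists (\big[Num.min/1]_(Y : {set I}) k Y); split.
  by apply: lt_bigmin => // Y _; case: (hk Y).
move=> Y hY z Kz hz; have [_] := hk Y; apply => // s /hz.
by move/le_trans; apply; exact: bigmin_le.
Qed.

Section perturbation.
Context {R : realType} {E : normedModType R} {d : nat} {coord : 'I_d -> E -> R}.
Hypotheses (hcoord : coordinates coord) (ccoord : forall i, continuous (coord i)).
Context {n : nat} (fs : seq (E -> R)) (K : set E) (phi : 'I_n -> E -> R).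
Hypotheses (hfs : objectives fs) (hK : convex_constraints K phi).
Variable (z0 : E).
Hypotheses (Kz0 : K z0) (Tz0 : forall s, phi s z0 <= 0).

Let opt0 := opt fs K phi (fun=> 0).
Let Tz0' : forall s, s \in [set: 'I_n]%SET -> phi s z0 <= (fun=> 0) s.
Proof. by []. Qed.

Let cvx_coord i : cvx_fun (coord i).
Proof.
move=> x y t _; rewrite hcoord.1 -[_ *: y]addr0 hcoord.1.
by rewrite (coord0 hcoord) addr0.
Qed.

Let objectives_cons F : cvx_fun F -> continuous F ->
  objectives (F :: codom coord).
Proof.
move=> cvxF cF; split=> [f|f|x y h].
- by rewrite inE => /orP[/eqP ->//|/codomP[i ->]].
- by rewrite inE => /orP[/eqP ->//|/codomP[i ->]].
- by apply: hcoord.2 => i; apply: h; rewrite inE codom_f orbT.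
Qed.

(* The relaxed program first minimises the distance to the convex hull of the
   optima that are better than [z]: at the relaxed optimum of a set of constraints
   satisfied by [z], it is positive if and only if [z] is the optimum. *)
Lemma exists_perturbation z : K z -> exists fs' e,
  [/\ objectives fs', forall s, 0 < e s,
    forall (Y : {set 'I_n}) s, s \notin Y ->
      phi s (opt fs' K phi e Y) != e s &
    forall Y Z : {set 'I_n}, Y \subset [set s | phi s z <= 0]%SET ->
      Z \subset [set s | phi s z <= 0]%SET ->
      opt fs' K phi e Y = opt fs' K phi e Z -> opt0 Y = z -> opt0 Z = z].
Proof.
move=> Kz; set T := [set s | phi s z <= 0]%SET.
(* These optima are strictly better than [z], because [z] is feasible for every [Y] included in
   [T]. *)
pose betters := [seq opt0 Y |
  Y : {set 'I_n} <- enum {set 'I_n} & (Y \subset T) && (opt0 Y != z)].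
have [F [cvxF cF Fbetters Fhull]] := exists_hull_gauge betters.
have [cK cvxK cvx_phi cphi] := hK.
have [kappa [kappa0 hkappa]] := compact_positive_gap cK cphi cF.
pose fs' := F :: codom coord.
(* The optimum of [Y] reads [e] only on [Y], which is the locality required. The bound [kappa] keeps
   [F] positive on the relaxed feasible set of any [Y] with optimum [z]. *)
have [e [he egen]] := @exists_generic R n
  (fun e Y s => phi s (opt fs' K phi e Y)) kappa kappa0
  ltac:(by move=> e e' Y s ee'; congr (phi _ (xget _ (lexmin _ _)));
    apply/seteqP; split=> x [Kx hx]; split=> // u uY; [rewrite -ee'//|rewrite ee'//];
    exact: hx).
have hfs' : objectives fs' by exact: objectives_cons.
exists fs', e; split=> // [s|Y Z YT ZT YZ Yz].
  by case/andP: (he s).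
have Tz s : s \in T -> phi s z <= e s.
  by rewrite inE => /le_trans; apply; case/andP: (he s) => /ltW.
have FY : 0 < F (opt fs' K phi e Y).
  have [KY hY] := opt_feas hfs' hK Kz Tz YT.
  apply: (hkappa Y) => // [x Kx hx|s sY]; last first.
    by apply: (le_trans (hY _ sY)); case/andP: (he s).
  rewrite ltNge; apply/negP => Fx.
  have : ~~ lexlt fs x z.
    by rewrite -Yz; apply: (opt_min hfs hK Kz0 Tz0' (finset.subsetT Y)).
  apply/negP/negPn; move: x Fx {Kx hx}.
  have [cvx_fs _ _] := hfs.
  apply: (Fhull [set x | lexlt fs x z]); first exact: cvx_lexlt.
  move=> q /mapP[X]; rewrite mem_filter => /andP[/andP[XT Xz] _] ->/=.
  apply: contraT => nlt; move/eqP: Xz; case.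
  have [_ _] := hfs; apply => f; apply: lexlt_antisym => //.
  apply: (opt_min hfs hK Kz0 Tz0' (finset.subsetT X)); split=> // s sX.
  by have := fintype.subsetP XT s sX; rewrite inE.
apply: contrapT => /eqP Zz.
have FZ : F (opt0 Z) <= 0.
  by apply: Fbetters; apply/mapP; exists Z => //; rewrite mem_filter ZT Zz mem_enum.
have : ~~ lexlt fs' (opt0 Z) (opt fs' K phi e Z).
  apply: (opt_min hfs' hK Kz Tz ZT).
  have [KZ hZ] := opt_feas hfs hK Kz0 Tz0' (finset.subsetT Z).
  split=> // s sZ; apply: (le_trans (hZ _ sZ)).
  by case/andP: (he s) => /ltW.
by rewrite /= -YZ (le_lt_trans FZ FY).
Qed.

(* Nondegenerate refinement of the program: any two sets of constraints with
   the same perturbed support have the same optimum before perturbation. *)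
Lemma exists_nondegenerate_supports : exists C U : {set 'I_n} -> {set 'I_n},
  [/\ forall Y, (#|C Y| <= d)%N,
    forall Y Z, (C Z == C Y) = (C Y \subset Z) && (Z \subset U (C Y)) &
    forall Y, U (C Y) \subset [set s | phi s (opt0 Y) <= 0]%SET].
Proof.
have /choice[fs' /choice[e he]] : forall z, exists fs' e, K z ->
  [/\ objectives fs', forall s, 0 < e s,
    forall (Y : {set 'I_n}) s, s \notin Y ->
      phi s (opt fs' K phi e Y) != e s &
    forall Y Z : {set 'I_n}, Y \subset [set s | phi s z <= 0]%SET ->
      Z \subset [set s | phi s z <= 0]%SET ->
      opt fs' K phi e Y = opt fs' K phi e Z -> opt0 Y = z -> opt0 Z = z].
  move=> z; have [/exists_perturbation[fs' [e h]]|nKz] := pselect (K z).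
    by exists fs', e.
  by exists [::], (fun=> 0).
pose T z := [set s | phi s z <= 0]%SET.
(* The perturbed program is selected by the original optimum. A support keeps this optimum
   ([classC]), so [U] recovers the right program from the support alone. *)
pose C Y := support_set (fs' (opt0 Y)) K phi (e (opt0 Y)) Y.
pose U B := satisfied (fs' (opt0 B)) K phi (e (opt0 B)) (T (opt0 B)) B.
have K0 Y : K (opt0 Y).
  by case: (opt_feas hfs hK Kz0 Tz0' (finset.subsetT Y)).
have T0 (Y : {set 'I_n}) : Y \subset T (opt0 Y).
  apply/fintype.subsetP => s sY; rewrite inE.
  by case: (opt_feas hfs hK Kz0 Tz0' (finset.subsetT Y)) => _; apply.
have Te z s : K z -> s \in T z -> phi s z <= e z s.
  by move=> Kz; rewrite inE => /le_trans; apply; case: (he z Kz) => _ /(_ s)/ltW.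
have cardC (Y : {set 'I_n}) : (#|C Y| <= d)%N.
  have [hfs' _ gen _] := he _ (K0 Y).
  exact: (card_support hcoord hfs' hK (K0 Y) (fun s => Te _ s (K0 Y)) gen (T0 Y)).
have CY (Y : {set 'I_n}) : C Y \subset Y by apply/fintype.subsetP => s; rewrite inE => /andP[].
have classC Y : opt0 (C Y) = opt0 Y.
  have [hfs' _ gen cl] := he _ (K0 Y).
  apply: (cl Y) => //; first exact: fintype.subset_trans (CY Y) (T0 Y).
  symmetry.
  exact: (opt_support hcoord hfs' hK (K0 Y) (fun s => Te _ s (K0 Y)) gen (T0 Y)).
exists C, U; split=> // [Y Z|Y]; last first.
  by rewrite /U classC; apply/fintype.subsetP => s; rewrite inE => /andP[].
have [hfs' _ gen cl] := he _ (K0 Y).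
have main (X : {set 'I_n}) : X \subset T (opt0 Y) ->
    (support_set (fs' (opt0 Y)) K phi (e (opt0 Y)) X == C Y) =
    (C Y \subset X) && (X \subset U (C Y)).
  move=> XT; rewrite /U classC.
  exact: (support_setE hcoord hfs' hK (K0 Y) (fun s => Te _ s (K0 Y)) gen (T0 Y) XT).
apply/idP/idP => [/eqP CZ|/andP[YZ ZU]].
  have oZ : opt0 Z = opt0 Y by rewrite -classC CZ classC.
  rewrite -main; last by rewrite -oZ; exact: T0.
  by rewrite -CZ /C oZ.
have ZT : Z \subset T (opt0 Y).
  apply: (fintype.subset_trans ZU); rewrite /U classC.
  by apply/fintype.subsetP => s; rewrite inE => /andP[].
have := main _ ZT; rewrite YZ ZU => /eqP CZ.
suff oZ : opt0 Z = opt0 Y by rewrite /C oZ CZ.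
apply: (cl Y) => //.
have oS X := opt_support hcoord hfs' hK (K0 Y) (fun s => Te _ s (K0 Y)) gen (Y := X).
by rewrite -[LHS]oS// -[RHS]oS// CZ.
Qed.

End perturbation.

(** The optimum of [Y] satisfies all of [U (C Y)], so [k] violators force [#|U (C Y)| + k <= n]. *)
Lemma card_violators {R : realType} {E : normedModType R} {d : nat}
    {coord : 'I_d.+1 -> E -> R} (hcoord : coordinates coord)
    (ccoord : forall i, continuous (coord i))
    {n : nat} (fs : seq (E -> R)) (K : set E) (phi : 'I_n -> E -> R)
    (hfs : objectives fs) (hK : convex_constraints K phi)
    (z0 : E) (Kz0 : K z0) (Tz0 : forall s, phi s z0 <= 0)
    (m k : nat) (x : R) : (d < m <= n)%N -> (k + d.+1 <= n)%N -> 0 < x <= 1 ->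
  #|[set Y : {set 'I_n} | (#|Y| == m) &&
      (k <= #|[set s | (0%R < phi s (opt fs K phi (fun=> 0) Y))%R]%SET|)%N]%SET|%:R
    * x ^+ d * m`!%:R <= (n%:R - (1 - x) * (k + d)%:R) ^+ m.
Proof.
move=> /andP[dm mn] kdn /andP[x0 x1].
have [C [U [Cd CU Uo]]] :=
  exists_nondegenerate_supports hcoord ccoord hfs hK Kz0 Tz0.
apply: le_trans (card_many_violators Cd CU dm mn kdn x0 x1).
rewrite ler_wpM2r// ler_wpM2r ?exprn_ge0 ?(ltW x0)// ler_nat.
apply: fintype.subset_leq_card; apply/fintype.subsetP => Y; rewrite !inE.
move=> /andP[-> kY]; rewrite andbT.
apply: (leq_trans (leq_add (fintype.subset_leq_card (Uo Y)) kY)).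
rewrite -cardsUI [X in (_ + #|pred_of_set X|)%N](_ : _ = finset.set0).
  by rewrite cards0 addn0 -[X in (_ <= X)%N]card_ord max_card.
by apply/setP => s; rewrite !inE; case: leP.
Qed.

(** * Measurability of optimisers and powers of a law *)

Section measurable_selection.
Context {R : realType} {E : topologicalType} {dT} {T : measurableType dT}.

(** By compactness infeasibility persists for slightly larger, hence for some rational bounds, so
    the complement is a countable union. The persistence is [compact_positive_gap] for [F = 0],
    whose conclusion [0 < 0] means infeasibility. *)
Lemma measurable_exists_le (K : set E) (I : finType) (g : I -> E -> R)
    (bd : I -> T -> R) : compact K -> (forall i, continuous (g i)) ->
  (forall i, measurable_fun setT (bd i)) ->
  measurable [set t | exists2 z, K z & forall i, g i z <= bd i t].
Proof.
move=> cK cg mbd; rewrite -[X in measurable X]setCK; apply: measurableC.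
pose D := [set r : {ffun I -> rat} |
  ~ exists2 z, K z & forall i, g i z <= ratr (r i)].
rewrite (_ : ~` _ = \bigcup_(r in D) \bigcap_(i in [set: I])
    (bd i @^-1` `]-oo, ratr (r i)])); last first.
  apply/seteqP; split=> [t /= nt|t [r Dr] /= hr [z Kz hz]]; last first.
    apply: Dr; exists z => // i; apply: (le_trans (hz i)).
    by have := hr i Logic.I; rewrite /= in_itv.
  have [kappa [kappa0 /(_ [set: I]%SET) hk]] :=
    @compact_positive_gap R E K I (fun i z => g i z - bd i t) (fun=> 0) cK
      ltac:(by move=> i z; apply: cvgB; [exact: cg|exact: cvg_cst])
      ltac:(by move=> z; exact: cvg_cst).
  have /choice[r hr] (i : I) : exists q : rat, bd i t < ratr q < bd i t + kappa.
    have [q] := @rat_in_itvoo R (bd i t) (bd i t + kappa) ltac:(by rewrite ltrDl).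
    by rewrite in_itv/= => hq; exists q.
  exists [ffun i => r i] => /=; last first.
    by move=> i _ /=; rewrite in_itv/= ffunE; case/andP: (hr i) => /ltW.
  move=> [z Kz hz]; suff : (0 : R) < 0 by rewrite ltxx.
  apply: (hk _ z Kz) => [z' Kz' hz'|i _].
    exfalso; apply: nt; exists z' => // i.
    by rewrite -subr_le0; apply: hz'; rewrite inE.
  rewrite lerBlDl; apply: (le_trans (hz i)); rewrite ffunE.
  by case/andP: (hr i) => _ /ltW.
rewrite bigcup_mkcond.
apply: countable_bigcupT_measurable => [|r]; first exact: countableP.
case: ifP => // _.
apply: fin_bigcap_measurable => // i _.
by rewrite -[X in measurable X]setTI; apply: mbd => //; exact: measurable_itv.
Qed.

Lemma measurable_fun_itv_le (f : T -> R) :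
  (forall y, measurable [set t | f t <= y]) -> measurable_fun setT f.
Proof.
move=> mf mT; apply: (measurability _ (RGenOInfty.measurableE R)) => //.
move=> _ [_ [y ->] <-]; rewrite setTI.
rewrite (_ : _ @^-1` _ = ~` [set t | f t <= y]); first exact: measurableC.
by apply/seteqP; split=> t /=; rewrite in_itv/= andbT ltNge => /negP.
Qed.

Lemma lexlt_prefix (U : Type) (fs1 fs2 : seq (U -> R)) f x y :
  ~~ lexlt (fs1 ++ f :: fs2) x y -> (forall g, g \in fs1 -> g x <= g y) ->
  f y <= f x.
Proof.
elim: fs1 => [|g fs1 ih] /=; rewrite negb_or -leNgt => /andP[yx h] le.
  by [].
have gxy : g x = g y by apply/eqP; rewrite eq_le yx le ?mem_head.
rewrite gxy eqxx/= in h; apply: ih => // g' g'fs; apply: le.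
by rewrite in_cons g'fs orbT.
Qed.

Variables (I : finType) (psi : I -> E -> R) (bd : I -> T -> R) (K : set E)
  (fs : seq (E -> R)) (o : T -> E).
Hypotheses (cK : compact K) (cpsi : forall i, continuous (psi i))
  (mbd : forall i, measurable_fun setT (bd i)).
Hypotheses (cfs : forall f, f \in fs -> continuous f)
  (fs_inj : forall x y, (forall f, f \in fs -> f x = f y) -> x = y).
Let F t := [set z | K z /\ forall i, bd i t <= psi i z].
Hypothesis lexmin_o : forall t, lexmin fs (F t) (o t).

Let measurable_prefix (gs : seq (E -> R)) (f : E -> R) y :
  (forall g, g \in gs -> continuous g) ->
  (forall g, g \in gs -> measurable_fun setT (g \o o)) -> continuous f ->
  measurable [set t | exists2 z, F t z &
    (forall g, g \in gs -> g z <= g (o t)) /\ f z <= y].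
Proof.
move=> cgs mgs cf; pose J := option (I + seq_sub gs)%type.
pose g (i : J) : E -> R := match i with
  | None => f
  | Some (inl j) => fun z => - psi j z
  | Some (inr h) => ssval h end.
pose b (i : J) : T -> R := match i with
  | None => fun=> y
  | Some (inl j) => fun t => - bd j t
  | Some (inr h) => fun t => ssval h (o t) end.
rewrite (_ : mkset _ = [set t | exists2 z, K z & forall i, g i z <= b i t]).
  apply: measurable_exists_le => //.
    case=> [[j|h]|]//=; last exact/cgs/ssvalP.
    by move=> z; apply: cvgN; exact: cpsi.
  case=> [[j|h]|]//=; last exact/mgs/ssvalP.
  exact: measurable_funN.
apply/seteqP; split=> [t [z [Kz hz] [h1 h2]]|t [z Kz hz]].
  exists z => // -[[j|h]|]//=; first by rewrite lerN2.
  exact/h1/ssvalP.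
exists z; first by split=> // i; have := hz (Some (inl i)); rewrite /= lerN2.
split; last exact: hz None.
by move=> h hgs; exact: hz (Some (inr (SeqSub hgs))).
Qed.

(** Induction on the rank of the objective: its optimal value is at most [y] iff some feasible point
    achieves this without being worse in the earlier objectives, whose measurable optimal values
    serve as bounds. *)
Lemma measurable_lexmin_value f : f \in fs -> measurable_fun setT (f \o o).
Proof.
suff h fs1 fs2 : fs = fs1 ++ fs2 ->
    forall f, f \in fs1 -> measurable_fun setT (f \o o).
  by move=> ffs; apply: (h fs [::]) => //; rewrite cats0.
elim/last_ind: fs1 fs2 => // fs1 g ih fs2 fsE f'.
have fsE' : fs = fs1 ++ g :: fs2 by rewrite fsE cat_rcons.
rewrite mem_rcons in_cons => /orP[/eqP ->|]; last exact: ih fsE' f'.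
have sub h : h \in fs1 -> h \in fs by rewrite fsE' mem_cat => ->.
have gfs : g \in fs by rewrite fsE' mem_cat mem_head orbT.
apply: measurable_fun_itv_le => y.
rewrite (_ : mkset _ = [set t | exists2 z, F t z &
    (forall g, g \in fs1 -> g z <= g (o t)) /\ g z <= y]).
  apply: measurable_prefix; last exact: cfs.
  - by move=> h /sub; exact: cfs.
  - exact: ih fsE'.
apply/seteqP; split=> [t /= oy|t [z Fz [h1 h2]]]; have /lexminP[Fo omin] := lexmin_o t.
  by exists (o t).
apply: le_trans h2; have := omin _ Fz; rewrite fsE' => nlt.
exact: lexlt_prefix nlt h1.
Qed.

(** A feasible point that is no worse than [o t] in any objective is [o t] itself, so a bound on
    [f (o t)] is again an existence statement with measurable bounds. *)
Lemma measurable_lexmin (f : E -> R) : continuous f -> measurable_fun setT (f \o o).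
Proof.
move=> cf; apply: measurable_fun_itv_le => y.
rewrite (_ : mkset _ = [set t | exists2 z, F t z &
    (forall g, g \in fs -> g z <= g (o t)) /\ f z <= y]).
  by apply: measurable_prefix => // g; exact: measurable_lexmin_value.
apply/seteqP; split=> [t /= oy|t [z Fz [h1 h2]]]; have /lexminP[Fo omin] := lexmin_o t.
  by exists (o t).
rewrite /= (_ : o t = z)//; apply: fs_inj => g gfs.
apply/esym/(lexlt_antisym (omin _ Fz)) => //.
move: (omin _ Fz) h1; clear; elim: fs => //= f' fs' ih.
rewrite !negb_or -!leNgt => /andP[h1 h2] le.
rewrite le ?mem_head//=; apply/nandP.
have [e|] := eqVneq; [right|by left].
apply: ih; last by move=> g gfs; apply: le; rewrite in_cons gfs orbT.
by move: h2; rewrite e eqxx.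
Qed.

End measurable_selection.

(** * Powers of a law on tuples *)

Section power_law.
Context {R : realType} {dX} {X : measurableType dX} (Pr : probability X R).
Local Open Scope ereal_scope.

Definition tuple_box n (D : 'I_n -> set X) : set (n.-tuple X) :=
  [set t | forall i, D i (tnth t i)].

Definition power_law n (mu : probability (n.-tuple X) R) :=
  forall D, (forall i, measurable (D i)) ->
    mu (tuple_box D) = \prod_(i < n) Pr (D i).

Lemma measurable_tuple_box n (D : 'I_n -> set X) :
  (forall i, measurable (D i)) -> measurable (tuple_box D).
Proof.
move=> mD; rewrite (_ : tuple_box D =
  \bigcap_(i in [set: 'I_n]) ((@tnth n X)^~ i @^-1` D i)).
  apply: fin_bigcap_measurable => // i _; rewrite -[X in measurable X]setTI.
  exact: measurable_tnth.
by apply/seteqP; split=> t ht i; [move=> _|]; exact: ht.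
Qed.

Lemma measurable_tuple_boxE n : @measurable _ (n.-tuple X) =
  <<s [set A | exists2 D : 'I_n -> set X,
    (forall i, measurable (D i)) & A = tuple_box D] >>.
Proof.
apply/seteqP; split; apply: smallest_sub; first exact: smallest_sigma_algebra.
- move=> A; rewrite -bigcup_seq => -[i _ [B mB <-]]; apply: sub_sigma_algebra.
  exists (fun j => if j == i then B else setT).
    by move=> j; case: ifP.
  rewrite setTI; apply/seteqP; split=> t /=.
    by move=> Bt j; case: ifP => // /eqP ->.
  by move=> /(_ i); rewrite eqxx.
- exact: sigma_algebra_measurable.
- by move=> _ [D mD ->]; exact: measurable_tuple_box.
Qed.

(** Boxes are stable under intersection and generate the sigma-algebra, so they determine the law of
    [F]. *)
Lemma power_law_transfer n (mu : probability (n.-tuple X) R) d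
    (Om : measurableType d) (P : probability Om R) (F : Om -> n.-tuple X) :
  power_law mu -> measurable_fun setT F ->
  (forall D, (forall i, measurable (D i)) ->
    P (F @^-1` tuple_box D) = \prod_(i < n) Pr (D i)) ->
  forall A, measurable A -> P (F @^-1` A) = mu A.
Proof.
move=> hmu mF hP A mA.
pose F' : {mfun Om >-> n.-tuple X} := mfun_Sub (mem_set mF).
suff -> : mu A = distribution P F' A by [].
apply/esym; apply: (measure_unique _ (fun=> setT) (measurable_tuple_boxE n)) => //.
- move=> _ _ [D1 mD1 ->] [D2 mD2 ->]; exists (fun i => D1 i `&` D2 i).
    by move=> i; exact: measurableI.
  by apply/seteqP; split=> t; [case=> h1 h2 i|move=> h; split=> i; case: (h i)].
- move=> i; exists (fun=> setT) => //.
  by apply/seteqP; split.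
- by apply/seteqP; split=> // t _; exists 0%N.
- by move=> _ [D mD ->]; exact: etrans (hP _ mD) (esym (hmu _ mD)).
- by move=> _; exact: (eq_ind_r (fun u => u < +oo) (ltry 1) (probability_setT (distribution P F'))).
Qed.

Lemma exists_power_law n : exists mu : probability (n.-tuple X) R, power_law mu.
Proof.
elim: n => [|n [mu hmu]].
  exists (dirac ([tuple] : 0.-tuple X)) => D mD; rewrite big_ord0.
  rewrite (_ : tuple_box D = setT); first exact: probability_setT.
  by apply/seteqP; split=> // t _ [].
pose f (xt : X * n.-tuple X) := [the n.+1.-tuple X of xt.1 :: xt.2].
have mf : measurable_fun setT f by exact: measurable_cons.
pose F : {mfun (X * n.-tuple X)%type >-> n.+1.-tuple X} := mfun_Sub (mem_set mf).
exists (distribution (Pr \x mu)%E F) => D mD.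
rewrite /distribution /pushforward/=.
rewrite (_ : _ @^-1` _ = D ord0 `*` tuple_box (fun i : 'I_n => D (lift ord0 i))).
  rewrite product_measure1E//; last exact: measurable_tuple_box.
  by rewrite big_ord_recl; congr (_ * _); exact: (hmu _ (fun i => mD _)).
apply/seteqP; split=> [[x t] /= h|[x t] [/= h0 h] i].
  by split=> [|i]; [exact: (h ord0)|have := h (lift ord0 i); rewrite tnthS].
by have [j ->|->//] := unliftP ord0 i; rewrite tnthS; exact: h.
Qed.

Lemma power_law_reindex n (mu : probability (n.-tuple X) R) (f : 'I_n -> 'I_n) A :
  power_law mu -> bijective f -> measurable A ->
  mu [set t | A [tuple tnth t (f i) | i < n]] = mu A.
Proof.
move=> hmu bf mA; have [g fg gf] := bf.
apply: (power_law_transfer hmu (F := fun t => [tuple tnth t (f i) | i < n])) => //.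
  apply/measurable_fun_tnthP => i.
  rewrite (_ : _ \o _ = (@tnth n X)^~ (f i)); first exact: measurable_tnth.
  by apply/funext => t /=; rewrite tnth_mktuple.
move=> D mD; rewrite (_ : _ @^-1` _ = tuple_box (fun i => D (g i))).
  by rewrite hmu// (reindex_onto f g)//=; apply: eq_big => [i|i _]; rewrite fg ?eqxx.
apply/seteqP; split=> t h i /=.
  by have := h (g i); rewrite tnth_mktuple gf.
by have := h (f i); rewrite tnth_mktuple fg.
Qed.

Lemma measurable_cat_tuple m q : measurable_fun setT
  (fun ab : m.-tuple X * q.-tuple X => cat_tuple ab.1 ab.2).
Proof.
apply/measurable_fun_tnthP => i.
have [j ->|j ->] := fintype.split_ordP i.
  rewrite (_ : _ \o _ = (@tnth m X)^~ j \o fst).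
    by apply: measurableT_comp => //; exact: measurable_tnth.
  by apply/funext => ab /=; rewrite tnth_lshift.
rewrite (_ : _ \o _ = (@tnth q X)^~ j \o snd).
  by apply: measurableT_comp => //; exact: measurable_tnth.
by apply/funext => ab /=; rewrite tnth_rshift.
Qed.

Lemma power_law_cat m q (mu1 : probability (m.-tuple X) R)
    (mu2 : probability (q.-tuple X) R) (mu : probability ((m + q).-tuple X) R) A :
  power_law mu1 -> power_law mu2 -> power_law mu -> measurable A ->
  (mu1 \x mu2) [set ab | A (cat_tuple ab.1 ab.2)] = mu A.
Proof.
move=> h1 h2 hmu mA.
apply: (power_law_transfer hmu (F := fun ab => cat_tuple ab.1 ab.2)) => //.
  exact: measurable_cat_tuple.
move=> D mD; rewrite (_ : _ @^-1` _ = tuple_box (fun i => D (lshift q i)) `*`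
    tuple_box (fun i => D (rshift m i))).
  rewrite big_split_ord/= product_measure1E.
  - by congr (_ * _); [exact: (h1 _ (fun i => mD _))|exact: (h2 _ (fun i => mD _))].
  - by apply: measurable_tuple_box => i; exact: mD.
  - by apply: measurable_tuple_box => i; exact: mD.
apply/seteqP; split=> [[a b] /= h|[a b] [/= ha hb] i].
  by split=> i; [have := h (lshift q i)|have := h (rshift m i)];
    rewrite ?tnth_lshift ?tnth_rshift.
have [j ->|j ->] := fintype.split_ordP i; first by rewrite tnth_lshift; exact: ha.
by rewrite tnth_rshift; exact: hb.
Qed.

End power_law.

Section finite_unions.
Context {R : realType} {d} {T : measurableType d}.
Local Open Scope ereal_scope.

Lemma measure_bigsetU_le (mu : {measure set T -> \bar R}) (I : Type)
    (s : seq I) (P : pred I) (F : I -> set T) : (forall i, measurable (F i)) ->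
  mu (\big[setU/set0]_(i <- s | P i) F i) <= \sum_(i <- s | P i) mu (F i).
Proof.
move=> mF; elim: s => [|i s ih]; first by rewrite !big_nil measure0.
rewrite !big_cons; case: ifP => // _.
apply: (le_trans (measureU2 _ _ _)) => //; first exact: bigsetU_measurable.
by rewrite leeD2l.
Qed.

(** The sum is the integral of the number of events that occur, which never exceeds [c]. *)
Lemma sum_measure_le (mu : probability T R) (I : finType) (P : pred I)
    (A : I -> set T) (c : R) : (forall i, measurable (A i)) ->
  (forall t, (#|[set i | P i && (t \in A i)]%SET|%:R <= c)%R) ->
  \sum_(i | P i) mu (A i) <= c%:E.
Proof.
move=> mA hc.
have -> : \sum_(i | P i) mu (A i) =
    \int[mu]_t (\sum_(i | P i) (\1_(A i) t)%:E).
  under eq_integral do rewrite -big_filter.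
  rewrite ge0_integral_sum//=.
  - by rewrite big_filter; apply: eq_bigr => i _; rewrite integral_indic// setIT.
  - by move=> i; exact/measurable_EFinP/measurable_indic.
rewrite -[leRHS]mule1 -(probability_setT mu) -integral_cst//.
apply: ge0_le_integral => //.
- by move=> t _; apply: sume_ge0 => i _; rewrite lee_fin.
- under eq_fun do rewrite -big_filter.
  by apply: emeasurable_sum => i; exact/measurable_EFinP/measurable_indic.
move=> t _; rewrite sumEFin lee_fin; apply: le_trans (hc t).
rewrite -sum1_card natr_sum big_mkcond/= [leRHS]big_mkcond/=.
apply: ler_sum => i _; rewrite inE indicE.
by case: ifP => //= _; case: (t \in A i).
Qed.

End finite_unions.

(** Chernoff bound. If [Pr A = a] and Z counts the samples in [A], then [y ^ Z] has mean
    [(1 - a * (1 - y)) ^+ q], and it is at least [y ^+ k] when Z is at most [k], as [y <= 1]. *)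
Lemma binomial_lower_tail {R : realType} {dX} {X : measurableType dX}
    (Pr : probability X R) q (mu : probability (q.-tuple X) R) (A : set X)
    (p y : R) k : power_law Pr mu -> measurable A -> (p%:E <= Pr A)%E ->
  0 < y <= 1 ->
  (mu [set t | (#|[set j | tnth t j \in A]%SET| <= k)%N]
    <= (y ^- k * (1 - p * (1 - y)) ^+ q)%:E)%E.
Proof.
move=> hmu mA pA /andP[y0 y1].
pose a := fine (Pr A).
have aE : Pr A = a%:E by rewrite fineK// fin_num_measure.
have aCE : Pr (~` A) = (1 - a)%:E by rewrite probability_setC// aE.
have a0 : 0 <= a by rewrite -lee_fin -aE.
have a1 : a <= 1 by rewrite -lee_fin -aE probability_le1.
have pa : p <= a by rewrite -lee_fin -aE.
pose D (Y : {set 'I_q}) i := if i \in Y then A else ~` A.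
have mD Y i : measurable (D Y i) by rewrite /D; case: ifP => // _; exact: measurableC.
have muD (Y : {set 'I_q}) : mu (tuple_box (D Y)) =
    (\prod_(i < q) (if i \in Y then a else 1 - a))%:E.
  rewrite hmu; last exact: mD.
  rewrite -prodEFin; apply: eq_bigr => i _; rewrite /D.
  by case: ifP.
rewrite (_ : mkset _ = \big[setU/set0]_(Y : {set 'I_q} | (#|Y| <= k)%N)
    tuple_box (D Y)); last first.
  apply/seteqP; split=> t /=.
    move=> tk; rewrite -(bigcup_pred [pred Y : {set 'I_q} | (#|Y| <= k)%N]).
    exists [set j | tnth t j \in A]%SET => // i; rewrite /D inE.
    by case: ifPn; [move=> /set_mem|rewrite notin_setE].
  rewrite -(bigcup_pred [pred Y : {set 'I_q} | (#|Y| <= k)%N]).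
  move=> [Y /= Yk ht]; rewrite (_ : [set _ | _]%SET = Y)//.
  apply/setP => i; rewrite inE; have := ht i; rewrite /D.
  by case: ifPn => _ h; [rewrite mem_set|apply/negbTE; rewrite notin_setE].
apply: (le_trans (measure_bigsetU_le _ _ _ _)).
  by move=> Y; apply: measurable_tuple_box; exact: mD.
rewrite (eq_bigr _ (fun Y _ => muD Y)).
rewrite sumEFin lee_fin mulrC ler_pdivlMr ?exprn_gt0//.
apply: (@le_trans _ _ ((a * y + (1 - a)) ^+ q)); last first.
  by apply: lerXn2r; rewrite ?nnegrE; nra.
have -> : (a * y + (1 - a)) ^+ q = \prod_(i < q) (a * y + (1 - a)).
  by rewrite prodr_const card_ord.
rewrite bigA_distr/=.
rewrite mulr_suml big_mkcond; apply: ler_sum => Y _.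
have prodE (u : R) : \prod_(i < q) (if i \in Y then u else 1 - a) =
    u ^+ #|Y| * (1 - a) ^+ (q - #|Y|).
  rewrite (bigID (mem Y))/= (eq_bigr (fun=> u)) => [|i ->//]; rewrite prodr_const.
  rewrite (eq_bigr (fun=> 1 - a)) => [|i /negbTE ->//]; rewrite prodr_const.
  have -> : (q - #|Y|)%N = #|(~: Y)%SET|.
    by rewrite [in RHS]cardsCs finset.setCK card_ord.
  by congr (_ * _ ^+ _); apply: eq_card => i; rewrite !inE.
rewrite !prodE; case: ifP => Yk; last first.
  by rewrite mulr_ge0 ?exprn_ge0 ?mulr_ge0 ?subr_ge0// ltW.
rewrite exprMn mulrAC ler_wpM2r ?exprn_ge0 ?subr_ge0//.
rewrite ler_wpM2l ?exprn_ge0//.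
by rewrite ler_wiXn2l ?(ltW y0).
Qed.

Lemma ler_bernoulli (R : realFieldType) (u : R) n : -1 <= u ->
  1 + n%:R * u <= (1 + u) ^+ n.
Proof.
move=> u1; have u0 : 0 <= 1 + u by lra.
elim: n => [|n ih]; first by rewrite mul0r addr0 expr0.
apply: (@le_trans _ _ ((1 + u) * (1 + n%:R * u))); last first.
  by rewrite exprS ler_wpM2l.
have : 0 <= n%:R * (u * u) by rewrite mulr_ge0// -expr2 sqr_ge0.
by rewrite -[n.+1%:R]natr1; nra.
Qed.

Lemma exists_chernoff_factor (R : realFieldType) (a b : nat) (eps : R) :
  0 < eps < 1 -> a%:R < eps * b%:R ->
  exists2 y, 0 < y <= 1 & y ^- a * (1 - eps * (1 - y)) ^+ b < 1.
Proof.
move=> /andP[e0 e1] ab; set c := eps * b%:R in ab.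
have c0 : 0 < c by exact: le_lt_trans ab.
(* Since [(1 - eps * s) ^+ b * (1 + eps * s) ^+ b <= 1], Bernoulli's inequality reduces the claim
   for [y = 1 - s] to [(1 - a * s) * (1 + c * s) > 1]. With this [s] the product is
   [1 + 2 * c * s ^+ 2], and both [s] and [a * s] stay below 1. *)
pose s := (c - a%:R) / (c * a.+2%:R).
have ca0 : 0 < c * a.+2%:R by rewrite mulr_gt0.
have s0 : 0 < s by rewrite divr_gt0// subr_gt0.
have sE : s * (c * a.+2%:R) = c - a%:R by rewrite divfK// gt_eqF.
have a0 : 0 <= a%:R :> R by [].
rewrite -[a.+2]addn2 natrD in sE.
have s1 : s < 1.
  have h : 0 <= a%:R * (s * c) := mulr_ge0 a0 (mulr_ge0 (ltW s0) (ltW c0)).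
  by rewrite -(ltr_pM2r c0); nra.
have bern1 := @ler_bernoulli R (- s) a ltac:(lra).
have bern2 := @ler_bernoulli R (eps * s) b ltac:(nra).
have es0 : 0 < eps * s := mulr_gt0 e0 s0.
have es1 : eps * s < 1 by nra.
exists (1 - s); first by apply/andP; split; lra.
rewrite (_ : 1 - (1 - s) = s); last by ring.
rewrite mulrC ltr_pdivrMr ?exprn_gt0 ?subr_gt0// mul1r.
apply: (@lt_le_trans _ _ (1 + a%:R * - s)) => //.
have h1 : 0 < (1 + eps * s) ^+ b by rewrite exprn_gt0//; lra.
rewrite -(ltr_pM2r h1) -exprMn.
apply: (@le_lt_trans _ _ 1).
  by apply: exprn_ile1; nra.
have h2 : 0 < 1 + a%:R * - s.
  have : a%:R * s < 1; last lra.
  rewrite -(ltr_pM2r c0); nra.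
apply: (@lt_le_trans _ _ ((1 + a%:R * - s) * (1 + b%:R * (eps * s)))).
  rewrite mulrCA mulrA -/c. 
  have : 0 < s * (s * c) := mulr_gt0 s0 (mulr_gt0 s0 c0).
  nra.
by rewrite ler_wpM2l// ltW.
Qed.

Lemma cvg_exprn {R : realType} {T : Type} {F : set_system T} {FF : Filter F}
    (f : T -> R) (l : R) m :
  f x @[x --> F] --> l -> f x ^+ m @[x --> F] --> l ^+ m.
Proof.
move=> fl; elim: m => [|m ih]; first exact: cvg_cst.
under eq_fun do rewrite exprS.
by rewrite exprS; exact: cvgM.
Qed.

(** * Violation probability of random convex programs *)

Section scenario_program.
Context {R : realType} {E : normedModType R} {d : nat}
  {coord : 'I_d.+1 -> E -> R}.
Hypotheses (hcoord : coordinates coord) (ccoord : forall i, continuous (coord i)).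
Context {dX} {X : measurableType dX} (Pr : probability X R).
Context {p : nat} (b : 'I_p -> X -> R) (psi : 'I_p -> E -> R).
Context (fs : seq (E -> R)) (K : set E) (z0 : E).
Hypotheses (mb : forall i, measurable_fun setT (b i))
  (cpsi : forall i, continuous (psi i))
  (cvx_psi : forall i, cvx_fun (fun z => - psi i z))
  (hfs : objectives fs) (cK : compact K) (cvxK : cvx_set K)
  (Kz0 : K z0) (b_psi0 : forall i w, b i w <= psi i z0).

(** The maximum merges all rows of a sample into one convex constraint, so that supports count
    samples and not rows. The default 0 is harmless because the constraint is [excess w z <= 0]. *)
Definition excess (w : X) (z : E) : R :=
  \big[Num.max/0]_(i < p) (b i w - psi i z).

Definition scenario_opt n (t : n.-tuple X) (Y : {set 'I_n}) : E :=
  opt fs K (fun s => excess (tnth t s)) (fun=> 0) Y.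

Lemma excess_le0 w z : (excess w z <= 0) <-> forall i, b i w <= psi i z.
Proof.
split=> [/bigmax_leP[_ h] i|h]; first by rewrite -subr_le0; exact: h.
by apply/bigmax_leP; split=> // i _; rewrite subr_le0.
Qed.

Lemma excess_constraints n (t : n.-tuple X) :
  convex_constraints K (fun s => excess (tnth t s)).
Proof.
split=> // s.
- apply: cvx_fun_bigmax => i x y u u01; rewrite /=.
  by have := cvx_psi i x y u01; lra.
- apply: continuous_bigmax => i z; apply: cvgB; first exact: cvg_cst.
  exact: cpsi.
Qed.

Let excess_z0 w : excess w z0 <= 0.
Proof. exact/excess_le0. Qed.

Lemma scenario_optP n (t : n.-tuple X) (Y : {set 'I_n}) :
  lexmin fs (feas K (fun s => excess (tnth t s)) (fun=> 0) Y) (scenario_opt t Y).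
Proof.
apply: (@lexmin_opt _ _ _ _ _ _ _ hfs (excess_constraints t) [set: 'I_n]%SET z0) => //.
Qed.

Lemma scenario_opt_feas n (t : n.-tuple X) (Y : {set 'I_n}) s : s \in Y ->
  excess (tnth t s) (scenario_opt t Y) <= 0.
Proof. by have /lexminP[[_ h] _] := scenario_optP t Y; exact: h. Qed.

Lemma measurable_scenario_opt n (Y : {set 'I_n}) (f : E -> R) : continuous f ->
  measurable_fun setT (fun t : n.-tuple X => f (scenario_opt t Y)).
Proof.
move=> cf; have [_ cfs fs_inj] := hfs.
apply: (@measurable_lexmin R E _ _ ({s : 'I_n | s \in Y} * 'I_p)%type
  (fun si => psi si.2) (fun si t => b si.2 (tnth t (sval si.1))) K fs
  (fun t => scenario_opt t Y)) => //.
- move=> [[s sY] i] /=; apply: measurableT_comp; [exact: mb|exact: measurable_tnth].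
- move=> t; have := scenario_optP t Y; congr lexmin.
  apply/seteqP; split=> z [Kz hz]; split=> //.
    by move=> [[s sY] i] /=; move: i; apply/excess_le0; exact: hz.
  by move=> s sY; apply/excess_le0 => i; exact: (hz (exist _ s sY, i)).
Qed.

Lemma measurable_violation dT (T : measurableType dT) n (F : T -> n.-tuple X)
    (W : T -> X) (Y : {set 'I_n}) : measurable_fun setT F ->
  measurable_fun setT W ->
  measurable [set t | 0 < excess (W t) (scenario_opt (F t) Y)].
Proof.
move=> mF mW; rewrite (_ : mkset _ = ~` \bigcap_(i in [set: 'I_p])
    ((fun t => psi i (scenario_opt (F t) Y) - b i (W t)) @^-1` `[0, +oo[)).
  apply: measurableC; apply: fin_bigcap_measurable => // i _.
  rewrite -[X in measurable X]setTI.
  have : measurable_fun setT (fun t => psi i (scenario_opt (F t) Y) - b i (W t)).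
    apply: measurable_funB; last by apply: measurableT_comp => //; exact: mb.
    have mo := measurable_scenario_opt Y (@cpsi i).
    exact: (measurableT_comp mo mF).
  by apply => //; exact: measurable_itv.
apply/seteqP; split=> t /=.
  rewrite ltNge => /negP h h'; apply: h; apply/excess_le0 => i.
  by have := h' i Logic.I; rewrite /= in_itv/= andbT subr_ge0.
move=> h; rewrite ltNge; apply/negP => /excess_le0 h'; apply: h => i _ /=.
by rewrite in_itv/= andbT subr_ge0.
Qed.

Definition violators n (t : n.-tuple X) (Y : {set 'I_n}) : {set 'I_n} :=
  [set s | 0 < excess (tnth t s) (scenario_opt t Y)]%SET.

Definition many_violators n k (Y : {set 'I_n}) : set (n.-tuple X) :=
  [set t | (k <= #|violators t Y|)%N].

Lemma measurable_many_violators n k (Y : {set 'I_n}) :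
  measurable (many_violators k Y).
Proof.
rewrite (_ : many_violators k Y = \bigcup_(Z in [set Z : {set 'I_n} | (k <= #|Z|)%N])
    \bigcap_(s in [set: 'I_n])
      (if s \in Z then [set t | 0 < excess (tnth t s) (scenario_opt t Y)]
       else ~` [set t | 0 < excess (tnth t s) (scenario_opt t Y)])).
  apply: fin_bigcup_measurable => // Z _; apply: fin_bigcap_measurable => // s _.
  have m : measurable [set t : n.-tuple X | 0 < excess (tnth t s) (scenario_opt t Y)].
    have := @measurable_violation _ (n.-tuple X) n id (fun t => tnth t s) Y.
    by apply; [exact: measurable_id|exact: measurable_tnth].
  by case: ifP => // _; exact: measurableC.
apply/seteqP; split=> [t /= tk|t [Z /= Zk h]].
  exists (violators t Y) => //= s _; rewrite inE; case: ifPn => //= h; exact/negP.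
rewrite /many_violators/= (_ : violators t Y = Z)//.
by apply/setP => s; have := h s Logic.I; rewrite inE; case: ifPn => //= _ /negP/negbTE.
Qed.

Lemma card_many_violators_tuple n (t : n.-tuple X) (m k : nat) (x : R) :
  (d < m <= n)%N -> (k + d.+1 <= n)%N -> 0 < x <= 1 ->
  #|[set Y : {set 'I_n} | (#|Y| == m) && (t \in many_violators k Y)]%SET|%:R
    * x ^+ d * m`!%:R <= (n%:R - (1 - x) * (k + d)%:R) ^+ m.
Proof.
move=> dmn kdn x01.
have := @card_violators R E d coord hcoord ccoord n fs K
  (fun s => excess (tnth t s)) hfs (excess_constraints t) z0 Kz0
  (fun s => excess_z0 _) m k x dmn kdn x01.
apply: le_trans; rewrite -!mulrA ler_wpM2r//.
  by rewrite mulr_ge0// exprn_ge0//; case/andP: x01 => /ltW.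
rewrite ler_nat; apply: fintype.subset_leq_card; apply/fintype.subsetP => Y.
by rewrite !inE => /andP[-> /set_mem].
Qed.

Lemma scenario_opt_reindex n (f : 'I_n -> 'I_n) (t : n.-tuple X) (Y : {set 'I_n}) :
  scenario_opt [tuple tnth t (f i) | i < n] Y = scenario_opt t (f @: Y)%SET.
Proof.
congr (xget _ (lexmin _ _)); apply/seteqP; split=> z [Kz h]; split=> //.
  by move=> _ /imsetP[s sY ->]; have := h s sY; rewrite tnth_mktuple.
by move=> s sY; rewrite tnth_mktuple; apply: h; exact: imset_f.
Qed.

Lemma many_violators_reindex n k (f : 'I_n -> 'I_n) (Y : {set 'I_n}) :
  injective f ->
  [set t | many_violators k Y [tuple tnth t (f i) | i < n]] =
  many_violators k (f @: Y)%SET.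
Proof.
move=> finj.
have cardE (t : n.-tuple X) : #|violators [tuple tnth t (f i) | i < n] Y| =
    #|violators t (f @: Y)%SET|.
  rewrite -(card_imset _ finj); congr #|pred_of_set _|; apply/setP => s.
  have [s' ->] : exists s', s = f s' by exists (invF finj s); rewrite f_invF.
  by rewrite (mem_imset _ _ finj) !inE tnth_mktuple scenario_opt_reindex.
by apply/seteqP; split=> t; rewrite /many_violators/= cardE.
Qed.

Lemma scenario_opt_cat m q (a : m.-tuple X) (c : q.-tuple X) :
  scenario_opt (cat_tuple a c) ((@lshift m q) @: [set: 'I_m])%SET =
  scenario_opt a [set: 'I_m]%SET.
Proof.
congr (xget _ (lexmin _ _)); apply/seteqP; split=> z [Kz h]; split=> //.
  by move=> s _; have := h (lshift q s); rewrite tnth_lshift; apply; exact: imset_f.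
by move=> _ /imsetP[s _ ->]; rewrite tnth_lshift; exact: h.
Qed.

Lemma exists_bijection_imset n (Y Z : {set 'I_n}) : #|Y| = #|Z| ->
  exists2 f : 'I_n -> 'I_n, bijective f & (f @: Y)%SET = Z.
Proof.
(* The enumeration of a set followed by that of its complement; [f] matches the two lists position
   by position. *)
move=> YZ; pose l (A : {set 'I_n}) := enum A ++ enum (~: A)%SET.
have l_uniq A : uniq (l A).
  rewrite cat_uniq !enum_uniq andbT/=; apply/hasPn => i.
  by rewrite !mem_enum inE.
have l_mem A i : i \in l A by rewrite mem_cat !mem_enum inE orbN.
have l_size A : size (l A) = n.
  by rewrite size_cat -!cardE cardsC card_ord.
pose f i := nth i (l Z) (index i (l Y)).
have idx i : (index i (l Y) < size (l Z))%N.
  by have := l_mem Y i; rewrite -index_mem !l_size.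
have finj : injective f.
  move=> i j; rewrite /f (set_nth_default i j)// => /eqP.
  rewrite nth_uniq// => /eqP e.
  by rewrite -(nth_index i (l_mem Y i)) e nth_index.
exists f; first exact: injF_bij.
apply/eqP; rewrite eqEcard card_imset// YZ leqnn andbT.
apply/fintype.subsetP => _ /imsetP[i iY ->].
have h : (index i (l Y) < #|Z|)%N.
  by rewrite -YZ cardE index_cat mem_enum iY index_mem mem_enum.
by rewrite /f nth_cat -cardE h -mem_enum mem_nth// -cardE.
Qed.

Section violation_bound.
Context {m : nat} (mu : probability (m.-tuple X) R) (eps x : R).
Hypotheses (hmu : power_law Pr mu) (dm : (d < m)%N) (eps01 : 0 < eps < 1)
  (x01 : 0 < x <= 1).

Definition large_violation : set (m.-tuple X) :=
  [set a | (eps%:E < Pr [set w | (0 < excess w (scenario_opt a [set: 'I_m]%SET))%R])%E].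

Lemma measurable_large_violation : measurable large_violation.
Proof.
pose G := [set aw : m.-tuple X * X |
  0 < excess aw.2 (scenario_opt aw.1 [set: 'I_m]%SET)].
have mG : measurable G by apply: measurable_violation.
have := measurable_fun_xsection Pr mG => mf.
rewrite (_ : large_violation = (Pr \o xsection G) @^-1` `]eps%:E, +oo[).
  rewrite -[X in measurable X]setTI; apply: mf => //.
  exact: emeasurable_itv.
apply/seteqP; split=> a; rewrite /large_violation/= in_itv/= andbT xsectionE//.
Qed.

(* [q] additional samples, of which at least [k.+1] violate the optimum of the
   first [m] ones with probability at least [1 - delta] if this optimum has a
   violation probability larger than [eps]. *)
Lemma violation_bound_step (q k : nat) (delta : R) : 0 <= delta <= 1 ->
  (forall mu2 : probability (q.-tuple X) R, power_law Pr mu2 ->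
    forall A, measurable A -> (eps%:E <= Pr A)%E ->
      (mu2 [set t | (#|[set j | tnth t j \in A]%SET| <= k)%N] <= delta%:E)%E) ->
  (k + d.+2 <= m + q)%N ->
  (1 - delta) * fine (mu large_violation) * ((m + q) ^_ m)%:R * x ^+ d <=
    ((m + q)%:R - (1 - x) * (k.+1 + d)%:R) ^+ m.
Proof.
move=> delta01 tail kq.
have [mun hmun] := exists_power_law Pr (m + q).
have [muq hmuq] := exists_power_law Pr q.
pose Y0 := ((@lshift m q) @: [set: 'I_m])%SET.
have Y0m : #|Y0| = m by rewrite card_imset ?cardsT ?card_ord//; exact: lshift_inj.
(* By exchangeability, the bound on the number of m-sets with many violators becomes a bound on the
   probability for [Y0]. *)
have munE (Y : {set 'I_(m + q)}) : #|Y| = m ->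
    mun (many_violators k.+1 Y) = mun (many_violators k.+1 Y0).
  move=> Ym; have [f bf fY0] := exists_bijection_imset (etrans Y0m (esym Ym)).
  rewrite -fY0 -many_violators_reindex; last exact: bij_inj.
  by rewrite (power_law_reindex hmun bf)//; exact: measurable_many_violators.
pose N := 'C(m + q, m); set M := mun (many_violators k.+1 Y0) in munE.
pose c := ((m + q)%:R - (1 - x) * (k.+1 + d)%:R) ^+ m / (x ^+ d * m`!%:R).
have x0 : 0 < x by case/andP: x01.
have xm0 : 0 < x ^+ d * m`!%:R :> R by rewrite mulr_gt0 ?exprn_gt0// ltr0n fact_gt0.
have ME : M = (fine M)%:E.
  by rewrite fineK// fin_num_measure//; exact: measurable_many_violators.
have upper : N%:R * fine M <= c.
  have := @sum_measure_le _ _ _ mun {set 'I_(m + q)}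
    [pred Y : {set 'I_(m + q)} | #|Y| == m]
    (many_violators k.+1) c.
  rewrite (eq_bigr (fun=> (fine M)%:E)) => [|Y /eqP /munE ->//].
  rewrite sumEFin lee_fin sumr_const.
  have -> : #|[pred Y : {set 'I_(m + q)} | #|Y| == m]| = N.
    rewrite /N -[X in 'C(X, _)](card_ord (m + q)) -card_draws.
    by apply: eq_card => Y; rewrite !inE.
  rewrite -[fine M *+ N]mulr_natl; apply => [Y|t]; first exact: measurable_many_violators.
  rewrite /c ler_pdivlMr// mulrA; apply: card_many_violators_tuple => //.
    by rewrite dm leq_addr.
  by rewrite addSn -addnS.
pose LV := large_violation.
pose S := [set ab : m.-tuple X * q.-tuple X | many_violators k.+1 Y0 (cat_tuple ab.1 ab.2)].
have mS : measurable S.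
  have := @measurable_cat_tuple _ X m q; rewrite -[X in _ -> measurable X]setTI.
  by apply => //; exact: measurable_many_violators.
have mLV := measurable_large_violation.
have mS' := measurable_fun_xsection muq mS.
have lower : (((1 - delta)%:E * mu LV)%E <= M)%E.
  have -> : M = (mu \x muq)%E S.
    by rewrite (power_law_cat hmu hmuq hmun)//; exact: measurable_many_violators.
  rewrite /product_measure1/= -integral_cst//.
  apply: (@le_trans _ _ (\int[mu]_(a in LV) (muq \o xsection S) a)%E); last first.
    by apply: ge0_subset_integral.
  apply: ge0_le_integral => //.
  - by move=> a _; rewrite lee_fin subr_ge0; case/andP: delta01.
  - exact: measurable_funS mS'.
  move=> a LVa /=; pose A := [set w | 0 < excess w (scenario_opt a [set: 'I_m]%SET)].
  have mA : measurable A.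
    rewrite /A; apply: (@measurable_violation _ X m (fun=> a) id) => //.
  (* The first [m] samples satisfy their own optimum, so every violator is one of the [q] new
     samples. For fixed [a] these are independent trials of the event [A]. *)
  have secE : ~` xsection S a = [set t | (#|[set j | tnth t j \in A]%SET| <= k)%N].
    have viol t : #|violators (cat_tuple a t) Y0| = #|[set j | tnth t j \in A]%SET|.
      rewrite -(card_imset _ (@rshift_inj m q)); congr #|pred_of_set _|.
      apply/setP => s; rewrite inE scenario_opt_cat.
      have [i ->|j ->] := fintype.split_ordP s.
        rewrite tnth_lshift ltNge (scenario_opt_feas a (finset.in_setT i))/=.
        by apply/esym/negbTE/imsetP => -[j _ /eqP]; rewrite eq_lrshift.
      rewrite tnth_rshift (mem_imset _ _ (@rshift_inj m q)) inE.
      by apply/idP/idP; rewrite /A; [move/mem_set|move/set_mem].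
    apply/seteqP; rewrite xsectionE; split=> t /=.
      by move/negP; rewrite /many_violators/= viol -leqNgt.
    by rewrite /S/= /many_violators/= viol => h; apply/negP; rewrite -leqNgt.
  rewrite -[xsection S a]setCK probability_setC; last first.
    by apply: measurableC; exact: measurable_xsection.
  rewrite EFinB leeB// secE; apply: tail => //; exact: ltW LVa.
move: lower; rewrite ME -[mu LV]fineK ?fin_num_measure// -EFinM lee_fin => lower.
rewrite -bin_ffact natrM -/N.
move: upper; rewrite /c ler_pdivlMr// => upper.
apply: le_trans upper.
rewrite (_ : _ * x ^+ d = (1 - delta) * fine (mu LV) * (N%:R * (x ^+ d * m`!%:R))).
  by rewrite [N%:R * fine M]mulrC -[leRHS]mulrA ler_wpM2r// mulr_ge0// ltW.
by rewrite /LV/=; ring.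
Qed.

Let P := fine (mu large_violation).
Let P0 : 0 <= P.
Proof. exact: fine_ge0. Qed.

(** With [q = b' * t.+1] and [k = a * t.+1] the ratio [k / q] is constant and the tail is the power
    [t.+1] of a fixed [r < 1]; what else depends on [t] is of order 1/t. *)
Let violation_bound_rat (a b' : nat) : a%:R < eps * b'%:R ->
  P * x ^+ d <= (1 - (1 - x) * (a%:R / b'%:R)) ^+ m.
Proof.
move=> ab; have [e0 e1] := andP eps01; have [x0 x1] := andP x01.
have b0 : 0 < b'%:R :> R by have := @ler0n R a; nra.
have ab' : (a < b')%N by rewrite -(ltr_nat R); nra.
have [y y01] := exists_chernoff_factor eps01 ab.
set r := y ^- a * _ => r1.
have [y0 y1] := andP y01.
have r0 : 0 <= r by rewrite /r mulr_ge0 ?invr_ge0 ?exprn_ge0 ?(ltW y0)//; nra.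
have step t : (1 - r ^+ t.+1) * (P * x ^+ d) <=
    (1 - (1 - x) * (a%:R / b'%:R) + m%:R / b'%:R * harmonic t) ^+ m.
  pose q := (b' * t.+1)%N; pose k := (a * t.+1)%N.
  have q0 : 0 < q%:R :> R by rewrite ltr0n muln_gt0 andbT -(ltr_nat R).
  have kq : (k + d.+2 <= m + q)%N.
    have : (a.+1 * t.+1 <= b' * t.+1)%N by rewrite leq_mul2r ab' orbT.
    rewrite mulSn -/k -/q; move: (k) (q) dm; clear.
    lia.
  have rt01 : 0 <= r ^+ t.+1 <= 1 by rewrite exprn_ge0//= exprn_ile1// ltW.
  have tail (mu2 : probability (q.-tuple X) R) : power_law Pr mu2 ->
    forall A, measurable A -> (eps%:E <= Pr A)%E ->
      (mu2 [set t | (#|[set j | tnth t j \in A]%SET| <= k)%N] <= (r ^+ t.+1)%:E)%E.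
    move=> hmu2 A mA eA; apply: le_trans (binomial_lower_tail k hmu2 mA eA y01) _.
    by rewrite lee_fin /r /k /q exprMn exprVn -!exprM.
  have := violation_bound_step rt01 tail kq; rewrite -/P => h.
  have hq : q%:R ^+ m * ((1 - r ^+ t.+1) * (P * x ^+ d)) <=
      (1 - r ^+ t.+1) * P * ((m + q) ^_ m)%:R * x ^+ d.
    rewrite [leRHS](_ : _ = ((m + q) ^_ m)%:R * ((1 - r ^+ t.+1) * (P * x ^+ d))).
      rewrite ler_wpM2r//.
        by rewrite !mulr_ge0 ?exprn_ge0 ?subr_ge0 ?(ltW x0)//; case/andP: rt01.
      (* Each of the [m] factors of the falling factorial is at least [q]. *)
      rewrite -natrX ler_nat; elim: (m) => // m' ih.
      by rewrite addSn ffactSS expnS leq_mul// leqW// leq_addl.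
    by ring.
  have {}h := le_trans hq h.
  have qm0 : 0 < q%:R ^+ m :> R by rewrite exprn_gt0.
  rewrite -(ler_pM2l qm0); apply: (le_trans h); rewrite -exprMn.
  have kq' : (k.+1 + d)%:R <= (m + q)%:R :> R.
    by rewrite ler_nat addSnnS (leq_trans _ kq)// leq_add2l.
  have kd0 : 0 <= (k.+1 + d)%:R :> R by [].
  have kle : k%:R <= (k.+1 + d)%:R :> R by rewrite ler_nat addSnnS leq_addr.
  have -> : q%:R * (1 - (1 - x) * (a%:R / b'%:R) + m%:R / b'%:R * harmonic t) =
      (m + q)%:R - (1 - x) * k%:R.
    rewrite /harmonic/= /q /k [(m + _)%:R]natrD !natrM.
    have T0 : t.+1%:R != 0 :> R by rewrite pnatr_eq0.
    have B0 : b'%:R != 0 :> R by rewrite gt_eqF.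
    move: (t.+1%:R) T0 (b'%:R) B0 => T T0 B B0.
    by field; rewrite B0 T0.
  by apply: lerXn2r; rewrite ?nnegrE; nra.
have cvgl : ((1 - r ^+ t.+1) * (P * x ^+ d)) @[t --> \oo] -->
    (1 - 0) * (P * x ^+ d).
  apply: cvgM; last exact: cvg_cst.
  apply: cvgB; first exact: cvg_cst.
  have : `|r| < 1 by rewrite ger0_norm.
  by move/cvg_expr; rewrite -(cvg_shiftS (fun t => r ^+ t)).
rewrite subr0 mul1r in cvgl.
have cvgr : (1 - (1 - x) * (a%:R / b'%:R) + m%:R / b'%:R * harmonic t) ^+ m
    @[t --> \oo] --> (1 - (1 - x) * (a%:R / b'%:R)) ^+ m.
  apply: cvg_exprn.
  rewrite -[X in _ --> X]addr0; apply: cvgD; first exact: cvg_cst.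
  rewrite -[X in _ --> X](mulr0 (m%:R / b'%:R)).
  by apply: cvgM; [exact: cvg_cst|exact: cvg_harmonic].
by apply: (ler_cvg_to cvgl cvgr); near=> t; exact: step.
Unshelve. all: by end_near. Qed.

(** Rationals [a / b'] tend to [eps] from below, and the right-hand side is continuous in [eps]. *)
Theorem violation_bound : P * x ^+ d <= (1 - (1 - x) * eps) ^+ m.
Proof.
rewrite leNgt; apply/negP => h; have [e0 e1] := andP eps01.
have : (1 - (1 - x) * u) ^+ m @[u --> eps] --> (1 - (1 - x) * eps) ^+ m.
  apply: cvg_exprn.
  by apply: cvgB; [exact: cvg_cst|apply: cvgM; [exact: cvg_cst|exact: cvg_id]].
move=> /cvgr_lt/(_ _ h)/nbhs_ballP[e /= e_gt0 he].
have [q] := @rat_in_itvoo R (Num.max 0 (eps - e)) eps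
  ltac:(by rewrite gt_max e0 ltrBlDr ltrDl).
rewrite in_itv/= gt_max => /andP[/andP[q0 qe] qeps].
have : ball eps e (ratr q) by rewrite /ball/= ger0_norm; lra.
move=> /he/=; apply/negP; rewrite -leNgt.
have q0' : 0 < q by rewrite -(ltr0q R).
have qE : ratr q = `|numq q|%N%:R / `|denq q|%N%:R :> R.
  rewrite -[in LHS](divq_num_den q) fmorph_div/= !ratr_int.
  by rewrite !natr_absz !ger0_norm ?denq_ge0// numq_ge0 ltW.
rewrite qE; apply: violation_bound_rat.
by rewrite -ltr_pdivrMr -?qE// ltr0n absz_gt0 denq_neq0.
Qed.

End violation_bound.

End scenario_program.

(** * Confidence and sample size *)

Section confidence.
Context {R : realType}.

Lemma prob_ge_setC d (T : measurableType d) (P : probability T R) (A N E : set T)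
    (p : R) : measurable A -> (P A <= p%:E)%E -> P.-negligible N ->
  (forall t, ~ A t -> ~ N t -> E t) -> prob_ge P E (1 - p).
Proof.
move=> mA PA [N' [mN' PN' NN']] sub.
exists (~` (A `|` N')); first split.
- by apply: measurableC; exact: measurableU.
- by move=> t /not_orP[At Nt]; apply: sub => // /NN'.
- rewrite probability_setC; last exact: measurableU.
  by rewrite measureU0// EFinB leeB.
Qed.

(** With [th = 1 - 1/e], [(1 - th * eps) ^+ m] is at most [expR (- th * eps * m)], and the sample
    size makes this at most [gamma * expR (-1) ^+ n]. *)
Lemma sample_size_bound (eps gamma : R) (n m : nat) :
  0 < eps < 1 -> 0 < gamma < 1 ->
  eps^-1 * (expR 1 / (expR 1 - 1)) * (ln gamma^-1 + n%:R) <= m%:R ->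
  (n < m)%N /\ forall p,
    p * expR (-1) ^+ n <= (1 - (1 - expR (-1)) * eps) ^+ m -> p <= gamma.
Proof.
move=> /andP[e0 e1] /andP[g0 g1].
have x0 : 0 < expR (-1) :> R by exact: expR_gt0.
have x1 : expR (-1) < 1 :> R by rewrite expR_lt1 ltrN10.
set th := 1 - expR (-1).
have th0 : 0 < th by rewrite subr_gt0.
have -> : expR 1 / (expR 1 - 1) = th^-1 :> R.
  have eN : expR 1 * expR (-1) = 1 :> R by rewrite -expRD addrN expR0.
  have e10 : expR 1 != 0 :> R by rewrite gt_eqF ?expR_gt0.
  have -> : expR 1 - 1 = expR 1 * th :> R by rewrite /th mulrBr mulr1 eN.
  by rewrite invfM mulrA mulfV// mul1r.
rewrite -invfM mulrC ler_pdivrMr ?mulr_gt0// => hm.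
have lg : 0 < ln gamma^-1 by rewrite ln_gt0// invf_gt1.
have eth : 0 <= eps * th <= 1 by rewrite /th; apply/andP; split; nra.
split.
  rewrite -(ltr_nat R); have := ler0n R m; case/andP: eth => _; nra.
have xn0 : 0 < expR (-1) ^+ n :> R by rewrite exprn_gt0.
move=> p hp; rewrite -(ler_pM2r xn0); apply: le_trans hp _.
have -> : gamma = expR (- ln gamma^-1).
  by rewrite lnV ?posrE// opprK lnK// posrE.
rewrite -expRM_natl mulrN1 -expRD -opprD.
apply: (@le_trans _ _ (expR (- (th * eps)) ^+ m)).
  rewrite lerXn2r ?nnegrE ?expR_ge0//; first by rewrite mulrC subr_ge0; case/andP: eth.
  exact: expR_ge1Dx.
by rewrite -expRM_natl ler_expR mulrN lerN2 [th * eps]mulrC.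
Qed.

End confidence.

(** * The support of a law on R^n *)

Section borel_vectors.
Context {R : realType} {n : nat}.

Lemma measurable_open_cV (U : set 'cV[R]_n) : open U ->
  measurable (U : set (borel_cV R n)).
Proof. by move=> oU; apply: sub_sigma_algebra. Qed.

Lemma measurable_closed_cV (U : set 'cV[R]_n) : closed U ->
  measurable (U : set (borel_cV R n)).
Proof.
move=> cU; rewrite -[U]setCK; apply: (@measurableC _ (borel_cV R n)).
by apply: measurable_open_cV; exact: closed_openC.
Qed.

Lemma continuous_measurable_cV (f : 'cV[R]_n -> R) : continuous f ->
  measurable_fun setT (f : borel_cV R n -> R).
Proof.
move=> cf; apply: measurable_fun_itv_le => y; apply: measurable_closed_cV.
by apply: (preimage_closed _ (@closed_le _ y)) => x _; exact: cf.
Qed.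

Variable Pr : probability (borel_cV R n) R.

Lemma closed_law_support : closed (law_support Pr).
Proof.
rewrite -[law_support Pr]setCK; apply: open_closedC.
rewrite openE => w /existsNP[U /not_implyP[oU /not_implyP[Uw PU]]].
apply: filterS (open_nbhs_nbhs (conj oU Uw)).
by move=> w' Uw' /(_ U oU Uw').
Qed.

Lemma rat_ball_cover (w : 'cV[R]_n) (e : R) : 0 < e -> exists (c : 'cV[rat]_n) (r : rat),
  ball (map_mx (ratr : rat -> R) c) (ratr r) w /\
  ball (map_mx (ratr : rat -> R) c) (ratr r) `<=` ball w e.
Proof.
move=> e0; have [r] := @rat_in_itvoo R 0 (e / 2) ltac:(by rewrite divr_gt0).
rewrite in_itv/= => /andP[r0 re].
have /choice[c hc] (i : 'I_n) : exists q : rat, `|ratr q - w i 0| < ratr r.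
  have [q] := @rat_in_itvoo R (w i 0 - ratr r) (w i 0 + ratr r) ltac:(lra).
  by rewrite in_itv/= => hq; exists q; rewrite ltr_distl; lra.
pose c' : 'cV[rat]_n := \col_i c i; exists c', r.
have cw : ball (map_mx (ratr : rat -> R) c') (ratr r) w.
  by split=> // i j; rewrite (ord1 j) !mxE; exact: hc.
split=> // x cx; apply: (@le_ball _ _ _ (ratr r + ratr r)); first lra.
by apply: ball_triangle cx; exact: ball_sym.
Qed.

(** Points outside the support have null neighbourhoods, which contain null balls of rational centre
    and radius; countably many of these cover the complement. *)
Lemma law_support_full : Pr (law_support Pr) = 1%E.
Proof.
pose B (k : nat) : set (borel_cV R n) :=
  if unpickle k is Some (c, r) then
    let U : set 'cV[R]_n := ball (map_mx (ratr : rat -> R) c) (ratr r) in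
    [set w | U w /\ Pr U = 0%E]
  else set0.
have negl k : Pr.-negligible (B k).
  rewrite /B; case: unpickle => [[c r]|]; last exact: negligible_set0.
  have [U0|U0] := pselect (Pr (ball (map_mx (ratr : rat -> R) c) (ratr r) : set 'cV[R]_n) = 0%E).
    exists (ball (map_mx (ratr : rat -> R) c) (ratr r) : set 'cV[R]_n); split=> //.
      by apply: measurable_open_cV; exact: ball_open.
    by move=> w [].
  by exists set0; split=> // w [_ /U0].
have mS : measurable (law_support Pr : set (borel_cV R n)).
  by apply: measurable_closed_cV; exact: closed_law_support.
have : Pr.-negligible (~` (law_support Pr : set (borel_cV R n))).
  apply: negligibleS (negligible_bigcup negl) => w.
  move=> /existsNP[U /not_implyP[oU /not_implyP[Uw PU]]].
  have [e /= e0 eU] : exists2 e : R, 0 < e & ball w e `<=` U.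
    by apply/nbhs_ballP; exact: open_nbhs_nbhs.
  have [c [r [cw cU]]] := rat_ball_cover w e0.
  exists (pickle (c, r)) => //; rewrite /B pickleK; split=> //.
  apply/eqP; rewrite eq_le measure_ge0 andbT.
  have PU0 : Pr U = 0%E.
    by apply/eqP; rewrite eq_le measure_ge0 andbT leNgt; exact/negP.
  rewrite -PU0; apply: le_measure; rewrite ?inE.
  - by apply: measurable_open_cV; exact: ball_open.
  - exact: measurable_open_cV.
  - exact: subset_trans cU eU.
case=> U [mU U0 sU]; apply/eqP; rewrite eq_le probability_le1//=.
have PU : Pr (~` U) = 1%E by rewrite probability_setC// U0 sube0.
rewrite -[leLHS]PU; apply: le_measure; rewrite ?inE//; first exact: measurableC.
by move=> w Uw; apply: contrapT => /sU.
Qed.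

End borel_vectors.

(** * Recursive feasibility *)

Section tube_dynamics.
Context {R : realType} {n : nat}.
Implicit Types (W : set 'cV[R]_n) (Phi : 'M[R]_n).

(** Otherwise 1 would be an eigenvalue of [Phi]. *)
Lemma strictly_stable_unit Phi : strictly_stable Phi -> 1%:M - Phi \in unitmx.
Proof.
move=> st; rewrite -(map_unitmx (real_complex R)) map_mxB map_mx1.
apply: contraT => nu; have : eigenvalue (map_mx (real_complex R) Phi) 1.
  rewrite /eigenvalue /eigenspace kermx_eq0 row_free_unit.
  by rewrite -opprB -scaleN1r unitmxZ ?unitrN1.
by move=> /st; rewrite normr1 ltxx.
Qed.

Lemma polytope_convex nV (V : 'M[R]_(nV, n)) x y (t : R) :
  polytope V x -> polytope V y -> 0 <= t <= 1 ->
  polytope V (t *: x + (1 - t) *: y).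
Proof.
move=> hx hy /andP[t0 t1] i; move: (hx i) (hy i).
rewrite mulmxDr -!scalemxAr !mxE => h1 h2.
have := ler_wpM2l t0 h1; have := ler_wpM2l (_ : 0 <= 1 - t) h2.
by rewrite subr_ge0 => /(_ t1); lra.
Qed.

Lemma polytope0 nV (V : 'M[R]_(nV, n)) : polytope V 0.
Proof. by move=> i; rewrite mulmx0 !mxE. Qed.

Lemma bigmsumP (X : nat -> set 'cV[R]_n) r x :
  (\big[@Defs.msum R n/[set 0]]_(0 <= i < r) X i) x <->
  exists2 f : nat -> 'cV[R]_n, forall i, (i < r)%N -> X i (f i) &
    x = \sum_(i < r) f i.
Proof.
elim: r X x => [|r IH] X x.
  rewrite big_geq//; split=> [->|[f _ ->]]; last by rewrite big_ord0.
  by exists (fun=> 0) => //; rewrite big_ord0.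
rewrite big_nat_recl//; split.
  move=> [a Xa [b /IH[f Xf ->] <-]].
  exists (fun i => if i is j.+1 then f j else a); first by case=> // i; apply: Xf.
  by rewrite big_ord_recl.
move=> [f Xf ->]; rewrite big_ord_recl; exists (f 0%N); first exact: Xf.
exists (\sum_(i < r) f i.+1) => //; apply/IH.
by exists (fun i => f i.+1) => // i ir; exact: Xf.
Qed.

Lemma compact_contraction_trivial W (rho : R) : compact W -> 0 <= rho < 1 ->
  W `<=` scset rho W -> forall w, W w -> w = 0.
Proof.
move=> cW /andP[r0 r1] sub w Ww.
have [z Wz hz] : exists2 z, W z & forall x, W x -> `|x| <= `|z|.
  have [||z] := @compact_EVT_max _ _ (fun x : 'cV[R]_n => `|x|) W _ cW.
  - by exists w.
  - by apply: continuous_subspaceT; exact: norm_continuous.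
  by rewrite inE => Wz hz; exists z => // x Wx; apply: hz; rewrite inE.
apply/eqP; rewrite -normr_le0; apply: le_trans (hz _ Ww) _.
have [z' Wz' zz'] := sub _ Wz.
have := hz _ Wz'; rewrite -{1 2}zz' normrZ ger0_norm//.
have := normr_ge0 z'; nra.
Qed.

Lemma tube_invariant nV (V : 'M[R]_(nV, n)) Phi r (rho : R) :
  compact (polytope V) -> 0 <= rho < 1 ->
  mxset (Phi ^+ r) (polytope V) `<=` scset rho (polytope V) ->
  forall e w, tube Phi (polytope V) r rho e -> polytope V w ->
  tube Phi (polytope V) r rho (Phi *m e + w).
Proof.
move=> cW hrho hr e w [_ /bigmsumP[f hf ->] <-] Ww.
have r1 : 1 - rho != 0 by move: hrho => /andP[_ ?]; rewrite subr_eq0 gt_eqF.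
(* For [r = 0] the tube is the empty sum {0}, and the contraction hypothesis forces the polytope to
   be {0}. *)
case: r hr f hf => [|r] hr f hf.
  have sub : polytope V `<=` scset rho (polytope V).
    by move=> z Wz; apply: hr; exists z => //; rewrite expr0 mul1mx.
  rewrite (compact_contraction_trivial cW hrho sub Ww) big_ord0 scaler0 mulmx0 addr0.
  exists 0; last by rewrite scaler0.
  by apply/bigmsumP; exists (fun=> 0) => //; rewrite big_ord0.
have /choice[g hg] (i : nat) : exists g, (i < r.+1)%N ->
    polytope V g /\ f i = Phi ^+ i *m g.
  case: (ltnP i r.+1) => [/hf[g Wg <-]|_]; last by exists 0.
  by exists g.
have [|w' Ww' hw'] := hr (Phi ^+ r.+1 *m g r).
  by exists (g r) => //; have [] := hg r (ltnSn _).
(* Applying [Phi] shifts the summands by one and pushes the last into [rho] times the polytope. It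
   is merged with [w], which enters as [(1 - rho) *: w] under the global factor [(1 - rho)^-1], into
   the new summand of index 0. *)
pose g0 := rho *: w' + (1 - rho) *: w.
exists (\sum_(i < r.+1) (if nat_of_ord i is j.+1 then Phi *m f j else g0)).
  apply/bigmsumP; exists (fun i => if i is j.+1 then Phi *m f j else g0) => //.
  case=> [_|i ir]; first exists g0; rewrite ?expr0 ?mul1mx//.
    by apply: polytope_convex => //; move: hrho => /andP[-> /ltW].
  have [Wg ->] := hg i (ltnW ir); exists (g i) => //.
  by rewrite exprS mulmxA.
rewrite big_ord_recl [in RHS]big_ord_recr/= -scalemxAr mulmxDr mulmx_sumr.
have [_ ->] := hg r (ltnSn _).
rewrite mulmxA -[Phi *m _]exprS -hw' /g0.
rewrite -[w in RHS](scalerK r1) !scalerDr -!addrA.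
by rewrite [LHS]addrA [LHS]addrC.
Qed.

(** The centre [invmx (1%:M - Phi) *m v] is the fixed point of [e |-> Phi *m e + v]; around it the
    tube scaled by [al] is invariant. *)
Lemma quantified_tube_invariant nV (V : 'M[R]_(nV, n)) Phi r (rho : R) v (al : R) :
  compact (polytope V) -> 0 <= rho < 1 ->
  mxset (Phi ^+ r) (polytope V) `<=` scset rho (polytope V) ->
  strictly_stable Phi ->
  let T := quantified_tube Phi (tube Phi (polytope V) r rho) v al in
  forall e w, T e -> homothet (polytope V) v al w -> T (Phi *m e + w).
Proof.
move=> cW hrho hr /strictly_stable_unit st T.
move=> _ _ [_ [e Se <-] [_ -> <-]] [_ -> [_ [w Ww <-] <-]].
exists (al *: (Phi *m e + w)).
  by exists (Phi *m e + w) => //; exact: tube_invariant.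
exists ((1 - al) *: (invmx (1%:M - Phi) *m v)) => //.
have key : invmx (1%:M - Phi) *m v = Phi *m (invmx (1%:M - Phi) *m v) + v.
  by rewrite -[X in _ = _ + X](mulKVmx st) mulmxBl mul1mx [RHS]addrC subrK.
rewrite [in LHS]key mulmxDr -!scalemxAr !scalerDr -!addrA; congr (_ + _).
by rewrite addrCA; congr (_ + _); rewrite addrC.
Qed.

End tube_dynamics.

Section recursive_feasibility.
Context {R : realType} (nx nu nc N : nat).

(** The window of powers [k] to [k + nuj] advances by one: admissibility applied to [Psi ^+ k *m z]
    gives the next power. *)
Lemma horizon_admissible_all p (Fb : 'M[R]_(nc, p)) (Psi : 'M[R]_p) h nuj z :
  horizon_admissible Fb Psi h nuj ->
  (forall i, (i <= nuj)%N -> Fb *m Psi ^+ i *m z <=v const_mx 1 - h) ->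
  forall i, Fb *m Psi ^+ i *m z <=v const_mx 1 - h.
Proof.
move=> [_ hadm] hz i.
suff H k : forall j, (j <= nuj)%N ->
    Fb *m Psi ^+ (k + j) *m z <=v const_mx 1 - h.
  by have := H i 0%N isT; rewrite addn0.
elim: k => [|k IH] j jn; first exact: hz.
case: (ltngtP j nuj) jn => // [jn _|-> _]; first by rewrite addSnnS; apply: IH.
have shift l : Fb *m Psi ^+ (k + l) *m z = Fb *m Psi ^+ l *m (Psi ^+ k *m z).
  by rewrite addnC exprD !mulmxA.
rewrite addSnnS shift; apply: hadm => l ln; rewrite -shift; exact: IH.
Qed.

(** The error [x - s] obeys [e |-> Phi *m e + w] and stays in the tube. The shifted point satisfies
    the constraints at all powers, hence over any new horizon [nuj']. *)
Lemma opt_feasible_shift (A Phi : 'M[R]_nx) (B : 'M[R]_(nx, nu))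
    (K : 'M[R]_(nu, nx))
    (Fb : 'M[R]_(nc, nx + \sum_(j < N) nu)) nV (V : 'M[R]_(nV, nx)) r (rho : R) v (al : R)
    h nuj nuj' x s c w :
  Phi = A + B *m K -> strictly_stable Phi ->
  compact (polytope V) -> 0 <= rho < 1 ->
  mxset (Phi ^+ r) (polytope V) `<=` scset rho (polytope V) ->
  let Psi := Psi_mx N Phi B in
  let T := quantified_tube Phi (tube Phi (polytope V) r rho) v al in
  horizon_admissible Fb Psi h nuj ->
  opt_constraints Fb Psi T h nuj x (s, c) ->
  homothet (polytope V) v al w ->
  opt_feasible Fb Psi T h nuj'
    (A *m x + B *m (K *m x + first_block nu N *m c) + w).
Proof.
move=> hPhi st cW hrho hr Psi T hadm [/= Txs hc] Ww.
pose s1 := Phi *m s + B *m first_block nu N *m c.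
pose c1 := upshift nu N *m c.
have eqPsi : col_mx s1 c1 = Psi *m col_mx s c.
  by rewrite mul_block_col mul0mx add0r.
exists (s1, c1); split => /= [|i _].
  have -> : A *m x + B *m (K *m x + first_block nu N *m c) + w - s1 =
            Phi *m (x - s) + w.
    rewrite /s1 hPhi !mulmxBr !mulmxDr !mulmxDl !mulmxA.
    by rewrite addrA [LHS]addrAC [- (_ + B *m _ *m c)]opprD addrACA subrr addr0.
  exact: quantified_tube_invariant.
have -> : Fb *m Psi ^+ i *m col_mx s1 c1 = Fb *m Psi ^+ i.+1 *m col_mx s c.
  by rewrite eqPsi exprSr !mulmxA.
exact: horizon_admissible_all hadm hc _.
Qed.

End recursive_feasibility.

(** * The learning program *)

Section learning_program.
Context {R : realType} {nx nV : nat} (V : 'M[R]_(nV, nx)).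
Local Notation E := ('cV[R]_nx * R)%type.

Lemma continuous_mulmx_coord m n (M : 'M[R]_(m, n)) i :
  continuous (fun y : 'cV[R]_n => (M *m y) i 0).
Proof.
have -> : (fun y : 'cV[R]_n => (M *m y) i 0) =
    (fun y => \sum_(j <- index_enum 'I_n) M i j * y j 0).
  by apply/funext => y; rewrite mxE.
move=> y; elim: (index_enum _) => [|j s IH].
  by under eq_fun do rewrite big_nil; exact: cst_continuous.
under eq_fun do rewrite big_cons.
have c1 : continuous_at y (fun y : 'cV[R]_n => M i j * y j 0).
  have c2 : continuous_at y (fun y : 'cV[R]_n => y j 0) by exact: coord_continuous.
  have c3 : continuous_at y (fun=> M i j) by exact: cst_continuous.
  exact: (cvgM c3 c2).
exact: (cvgD c1 IH).
Qed.

(** All nonnegative multiples of [u] lie in the polytope, which is bounded. *)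
Lemma recession_cone_trivial (u : 'cV[R]_nx) : compact (polytope V) ->
  V *m u <=v 0 -> u = 0.
Proof.
move=> cW Vu; have [||z _ hz] := @compact_EVT_max _ _ (fun x : 'cV[R]_nx => `|x|) _ _ cW.
- by exists 0; exact: polytope0.
- by apply: continuous_subspaceT; exact: norm_continuous.
apply/eqP; apply: contraT => u0; have nu0 : 0 < `|u| by rewrite normr_gt0.
pose t := (`|z| + 1) / `|u|.
have t0 : 0 <= t by rewrite divr_ge0// addr_ge0.
have : t *: u \in polytope V.
  rewrite inE => i; rewrite -scalemxAr !mxE.
  by have := Vu i; rewrite !mxE => h; rewrite (le_trans (ler_wpM2l t0 h))// mulr0 ler01.
by move=> /hz; rewrite normrZ ger0_norm// /t divfK ?gt_eqF// gerDl ler10.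
Qed.

Definition lp_coord (i : 'I_nx.+1) (z : E) : R :=
  if unlift ord0 i is Some j then z.1 j 0 else z.2.

Lemma lp_coordP : coordinates lp_coord.
Proof.
rewrite /lp_coord; split=> [i a x y|x y xy].
  by case: unlift => [j|] //=; rewrite !mxE.
have := xy ord0; rewrite unlift_none.
case: x y xy => [x1 x2] [y1 y2] xy /= ->; congr pair; apply/colP => j.
by have := xy (lift ord0 j); rewrite liftK.
Qed.

Lemma continuous_lp_coord i : continuous (lp_coord i).
Proof.
rewrite /lp_coord; case: unlift => [j|] z; last exact: cvg_snd.
apply: (@continuous_comp _ _ _ fst (fun y : 'cV[R]_nx => y j 0)); first exact: cvg_fst.
exact: coord_continuous.
Qed.

Definition lp_rhs (i : 'I_nV) (z : E) : R := 1 - z.2 + (V *m z.1) i 0.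

(* Equal to [(V *m w) i 0] for [w] in the polytope; the minimum makes [y = 0],
   [beta = 0] feasible for all samples. *)
Definition lp_lhs (i : 'I_nV) (w : borel_cV R nx) : R :=
  Num.min ((V *m (w : 'cV[R]_nx)) i 0) 1.

Definition lp_box : set E :=
  [set z | V *m z.1 <=v z.2 *: const_mx 1 /\ 0 <= z.2 <= 1].

Lemma continuous_mulmx_fst i : continuous (fun z : E => (V *m z.1) i 0).
Proof.
move=> z; apply: (@continuous_comp _ _ _ fst (fun y : 'cV[R]_nx => (V *m y) i 0)).
  exact: cvg_fst.
exact: continuous_mulmx_coord.
Qed.

Lemma continuous_lp_rhs i : continuous (lp_rhs i).
Proof.
move=> z; apply: cvgD; last exact: continuous_mulmx_fst.
by apply: cvgB; [exact: cst_continuous|exact: cvg_snd].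
Qed.

Lemma cvx_lp_rhs i : cvx_fun (fun z => - lp_rhs i z).
Proof.
move=> x y t _; rewrite /lp_rhs/= mulmxDr -!scalemxAr !mxE.
by rewrite le_eqVlt; apply/orP; left; apply/eqP; rewrite /GRing.scale/=; ring.
Qed.

Lemma measurable_lp_lhs i : measurable_fun setT (lp_lhs i).
Proof.
apply: measurable_minr => //; apply: continuous_measurable_cV.
exact: continuous_mulmx_coord.
Qed.

Lemma lp_lhs_le i w : lp_lhs i w <= lp_rhs i 0.
Proof.
by rewrite /lp_rhs/= mulmx0 subr0 mxE addr0 /lp_lhs ge_min lexx orbT.
Qed.

Lemma lp_box0 : lp_box 0.
Proof. by split=> [i|/=]; rewrite ?mulmx0 ?scale0r ?lexx ?ler01. Qed.

Lemma cvx_lp_box : cvx_set lp_box.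
Proof.
move=> x y t t01 [hx x01] [hy y01]; have [t0 t1] := andP t01; split=> /=.
  move=> i; move: (hx i) (hy i); rewrite mulmxDr -!scalemxAr !mxE /GRing.scale/= !mulr1 => h1 h2.
  by rewrite lerD// ler_wpM2l// subr_ge0.
by rewrite /GRing.scale/=; move: x01 y01 => /andP[? ?] /andP[? ?]; apply/andP; split; nra.
Qed.

Lemma compact_lp_box : compact (polytope V) -> compact lp_box.
Proof.
move=> cW.
have -> : lp_box = (polytope V `*` `[0, 1]) `&`
    \bigcap_(i in [set: 'I_nV]) 
      ((fun z : E => (V *m z.1) i 0 - z.2) @^-1` [set a | a <= 0]).
  apply/seteqP; split=> z.
    move=> [hz z01]; split; last first.
      by move=> i _ /=; rewrite subr_le0; have := hz i; rewrite !mxE mulr1.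
    split; last by rewrite /= in_itv.
    move=> i; have := hz i; rewrite !mxE mulr1 => /le_trans; apply.
    by case/andP: z01.
  move=> [[_ /=]]; rewrite in_itv/= => z01 hz; split=> // i.
  by rewrite !mxE mulr1 -subr_le0; have := hz i Logic.I; rewrite /= mxE.
apply: compact_closedI.
  by apply: compact_setX => //; exact: segment_compact.
apply: closed_bigI => i _.
apply: (preimage_closed _ (@closed_le _ 0)) => z _.
by apply: cvgB; [exact: continuous_mulmx_fst|exact: cvg_snd].
Qed.

Variable ts : seq ('cV[R]_nx -> R).

(* The coordinates are appended to make the minimiser unique for arbitrary
   samples; for samples in the support of the law they play no role. *)
Definition lp_objectives : seq (E -> R) :=
  ((fun z => - z.2) :: [seq (fun z => t z.1) | t <- ts]) ++ codom lp_coord.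

Context (Wtrue : set 'cV[R]_nx) (m : nat).
Hypotheses (hts : tie_break_rule V ts m Wtrue) (hWtrue : Wtrue `<=` polytope V)
  (cW : compact (polytope V)).

Lemma lp_objectivesP : objectives lp_objectives.
Proof.
have tsP f : f \in [seq (fun z : E => t z.1) | t <- ts] ->
    exists2 t, f = (fun z => t z.1) &
      continuous t /\ @convex_function _ 'cV[R]_nx setT t.
  move=> /(nthP (fun=> 0))[j]; rewrite size_map => jts <-.
  exists (nth (fun=> 0) ts j); first by rewrite (nth_map (fun=> 0)).
  exact: hts.1.
split=> [f|f|x y xy].
- rewrite mem_cat inE => /orP[/orP[/eqP -> x y t _|/tsP[t -> [_ cvxt]] x y u u01]|].
  + by rewrite le_eqVlt; apply/orP; left; apply/eqP => /=; rewrite /GRing.scale/=; ring.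
  + have [u0 u1] := andP u01.
    by have := cvxt (Itv01 u0 u1) x.1 y.1; rewrite !in_setT => /(_ isT isT); exact.
  + move=> /codomP[i ->] x y t _.
    by rewrite lp_coordP.1 -[_ *: y]addr0 lp_coordP.1 coord0 ?addr0//; exact: lp_coordP.
- rewrite mem_cat inE => /orP[/orP[/eqP ->|/tsP[t -> [ct _]]]|/codomP[i ->]].
  + by move=> z; apply: cvgN; exact: cvg_snd.
  + move=> z; apply: (@continuous_comp _ _ _ fst t); first exact: cvg_fst.
    exact: ct.
  + exact: continuous_lp_coord.
- apply: lp_coordP.2 => i; apply: xy.
  by rewrite mem_cat codom_f orbT.
Qed.

Lemma lexmin_cat T (s1 s2 : seq (T -> R)) X :
  lexmin (s1 ++ s2) X = lexmin s2 (lexmin s1 X).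
Proof. by elim: s1 X => //= t s1 IH X; rewrite IH. Qed.

Lemma lexmin_sub T (s : seq (T -> R)) X : lexmin s X `<=` X.
Proof. by elim: s X => [|t s IH] X z //= /IH[]. Qed.

Local Notation lp_excess := (excess lp_lhs lp_rhs).

Lemma lp_lhs_polytope w : polytope V w -> forall i, lp_lhs i w = (V *m w) i 0.
Proof. by move=> hw i; rewrite /lp_lhs min_l//; have := hw i; rewrite [leRHS]mxE. Qed.

Lemma lp_feasible_feas (w : 'I_m -> 'cV[R]_nx) : (forall s, polytope V (w s)) ->
  lp_feasible V w =
  feas lp_box (fun s => lp_excess (w s)) (fun=> 0) [set: 'I_m]%SET.
Proof.
move=> hw; apply/seteqP; split=> z.
  move=> [h1 [h2 h3]]; split=> // s _; apply/excess_le0 => i.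
  by rewrite lp_lhs_polytope//; have := h1 s i; rewrite /lp_rhs !mxE; lra.
move=> [[h2 h3] h1]; split=> // s i.
have /excess_le0/(_ i) := h1 s (finset.in_setT s).
by rewrite lp_lhs_polytope// /lp_rhs !mxE; lra.
Qed.

(** Appending objectives only refines the set of minimisers, so the scenario optimum is one of the
    optimisers of the rule, and for samples in the support there is at most one. *)
Lemma lp_optimiser_scenario (w : 'I_m -> 'cV[R]_nx) z :
  (forall s, Wtrue (w s)) -> lp_optimiser V ts w z ->
  z = scenario_opt lp_lhs lp_rhs lp_objectives lp_box
        [tuple (w s : borel_cV R nx) | s < m] [set: 'I_m]%SET.
Proof.
move=> hw hz; apply: (hts.2 w hw) => //.
have lpE : lp_optimiser V ts w =
    lexmin ((fun z => - z.2) :: [seq (fun z => t z.1) | t <- ts]) (lp_feasible V w).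
  rewrite /lp_optimiser/=; congr lexmin; apply/seteqP; split=> z' [h1 h2].
    by split=> // z'' /h2; rewrite lerN2.
  by split=> // z'' /h2; rewrite lerN2.
rewrite lpE; apply: (@lexmin_sub _ (codom lp_coord)).
rewrite -lexmin_cat lp_feasible_feas; last by move=> s; apply: hWtrue.
have := scenario_optP continuous_lp_rhs cvx_lp_rhs lp_objectivesP
  (compact_lp_box cW) cvx_lp_box lp_box0 lp_lhs_le
  [tuple (w s : borel_cV R nx) | s < m] [set: 'I_m]%SET.
congr lexmin; congr feas; apply/funext => s; by rewrite tnth_mktuple.
Qed.

(** For [0 < beta < 1] the point [(1 - beta)^-1 *: (w - y)] lies in the polytope. For [beta = 0] the
    homothet is the whole polytope, and for [beta = 1] the vector [w - y] is a recession direction,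
    hence 0. *)
Lemma excess_homothet y beta v alpha w :
  lp_box (y, beta) -> quantified_by (polytope V) y beta v alpha ->
  polytope V w -> lp_excess w (y, beta) <= 0 -> homothet (polytope V) v alpha w.
Proof.
move=> [_ /= /andP[]] + + [-> [vy _]] Ww /excess_le0 hw.
rewrite le_eqVlt => /orP[/eqP <- _|b0 b1].
  exists ((1 - (1 - 0)) *: v) => //; exists (1 *: w).
    by exists w => //; rewrite subr0.
  by rewrite subr0 subrr scale0r scale1r add0r.
have hVw i : (V *m (w - y)) i 0 <= 1 - beta.
  by have := hw i; rewrite lp_lhs_polytope// /lp_rhs/= mulmxBr !mxE; lra.
exists ((1 - (1 - beta)) *: v) => //; rewrite subKr (vy b0) scalerA mulfV ?gt_eqF// scale1r.
exists (w - y); last by rewrite addrC subrK.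
move: b1; rewrite le_eqVlt => /orP[/eqP b1|b1].
  exists 0; first exact: polytope0.
  rewrite scaler0; symmetry; apply: recession_cone_trivial => // i.
  by rewrite [leRHS]mxE; have := hVw i; rewrite b1 subrr.
exists ((1 - beta)^-1 *: (w - y)).
  move=> i; rewrite -scalemxAr [leLHS]mxE [leRHS]mxE.
  by rewrite ler_pdivrMl ?subr_gt0// mulr1.
by rewrite scalerA mulfV ?scale1r// subr_eq0 gt_eqF.
Qed.

End learning_program.
Theorem proposition7 (R : realType)
  (* system, constraints, disturbance bound *)
  (nx nu nc nV N r m : nat) (hN : (0 < N)%N)
  (A : 'M[R]_nx) (B : 'M[R]_(nx, nu))
  (F : 'M[R]_(nc, nx)) (G : 'M[R]_(nc, nu))
  (V : 'M[R]_(nV, nx)) (W : set 'cV[R]_nx)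
  (hAB : stabilisable A B)
  (hW : W = polytope V) (hWc : compact W)
  (* disturbance distribution *)
  (Pr : probability (borel_cV R nx) R)
  (hPrc : @convex_set R 'cV[R]_nx (law_support Pr)) (hPrW : law_support Pr `<=` W)
  (* gain *)
  (Q : 'M[R]_nx) (Rc : 'M[R]_nu) (Px : 'M[R]_nx)
  (K : 'M[R]_(nu, nx)) (Phi : 'M[R]_nx)
  (hQ : possemidef Q) (hRc : posdef Rc) (hAQ : observable A Q)
  (hPx : posdef Px) (hric : riccati A B Q Rc Px)
  (hPxu : forall P' : 'M[R]_nx, posdef P' -> riccati A B Q Rc P' -> P' = Px)
  (hK : K = - (invmx (B^T *m Px *m B + Rc) *m B^T *m Px *m A))
  (hPhi : Phi = A + B *m K) (hPhis : strictly_stable Phi)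
  (* tube *)
  (rho : R) (S : set 'cV[R]_nx) (hrho : 0 <= rho < 1)
  (hr : mxset (Phi ^+ r) W `<=` scset rho W)
  (hS : S = tube Phi W r rho)
  (* prediction matrices *)
  (Fbar : 'M[R]_(nc, nx + \sum_(j < N) nu)) (Psi : 'M[R]_(nx + \sum_(j < N) nu))
  (hFbar : Fbar = Fbar_mx N F G K) (hPsi : Psi = Psi_mx N Phi B)
  (* the m disturbance samples available at time k *)
  (d : measure_display) (Om : measurableType d) (P : probability Om R)
  (ws : 'I_m -> {RV P >-> borel_cV R nx}) (hws : iid Pr ws)
  (epsilon gamma : R) (heps : 0 < epsilon < 1) (hgam : 0 < gamma < 1)
  (hm : epsilon^-1 * (expR 1 / (expR 1 - 1)) * (ln (gamma^-1) + nx%:R) <= m%:R)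
  (* quantified disturbance set and tube at time k *)
  (ts : seq ('cV[R]_nx -> R)) (hts : tie_break_rule V ts m (law_support Pr))
  (y : Om -> 'cV[R]_nx) (beta : Om -> R)
  (v : Om -> 'cV[R]_nx) (alpha : Om -> R)
  (Shat : Om -> set 'cV[R]_nx) (h : Om -> 'cV[R]_nc) (nuk : Om -> nat)
  (hy : {ae P, forall o, lp_optimiser V ts (fun s => ws s o) (y o, beta o)})
  (hv : {ae P, forall o, quantified_by W (y o) (beta o) (v o) (alpha o)})
  (hShat : forall o, Shat o = quantified_tube Phi S (v o) (alpha o))
  (hh : forall o, h o = max_over (F + G *m K) (Shat o))
  (hnuk : {ae P, forall o, horizon_admissible Fbar Psi (h o) (nuk o)})
  (* state at time k, solution of the problem at time k, applied input *)
  (x : Om -> 'cV[R]_nx)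
  (s : Om -> 'cV[R]_nx) (c : Om -> 'cV[R]_(\sum_(j < N) nu))
  (u : Om -> 'cV[R]_nu)
  (hsc : {ae P, forall o,
     opt_feasible Fbar Psi (Shat o) (h o) (nuk o) (x o) ->
     opt_minimiser Px (B^T *m Px *m B + Rc)
       Fbar Psi (Shat o) (h o) (nuk o) (x o) (s o, c o)})
  (hu : forall o, u o = K *m x o + first_block nu N *m c o)
  (* time k+1, as a function of the realisation w of the disturbance w_k *)
  (x1 : Om -> 'cV[R]_nx -> 'cV[R]_nx)
  (v1 : Om -> 'cV[R]_nx -> 'cV[R]_nx) (alpha1 : Om -> 'cV[R]_nx -> R)
  (Shat1 : Om -> 'cV[R]_nx -> set 'cV[R]_nx)
  (h1 : Om -> 'cV[R]_nx -> 'cV[R]_nc) (nuk1 : Om -> 'cV[R]_nx -> nat)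
  (hx1 : forall o w, x1 o w = A *m x o + B *m u o + w)
  (hv1 : {ae P, forall o, forall w, law_support Pr w ->
     online_update W (v o) (alpha o) w (v1 o w) (alpha1 o w)})
  (hShat1 : forall o w,
     Shat1 o w = quantified_tube Phi S (v1 o w) (alpha1 o w))
  (hh1 : forall o w, h1 o w = max_over (F + G *m K) (Shat1 o w))
  (hnuk1 : {ae P, forall o, forall w, law_support Pr w ->
     horizon_admissible Fbar Psi (h1 o w) (nuk1 o w)}) :
  prob_ge P
    [set o | opt_feasible Fbar Psi (Shat o) (h o) (nuk o) (x o) ->
       prob_ge Pr
         [set w | opt_feasible Fbar Psi
                    (Shat1 o w) (h1 o w) (nuk1 o w) (x1 o w)]
         (1 - epsilon)]
    (1 - gamma).
Proof.
subst W S Fbar Psi.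
have [nm conf] := sample_size_bound heps hgam hm.
pose t o := [tuple (ws i o : borel_cV R nx) | i < m].
have objs := lp_objectivesP hts.
have cB := compact_lp_box hWc.
pose Z (a : m.-tuple (borel_cV R nx)) :=
  scenario_opt (lp_lhs V) (lp_rhs V) (lp_objectives ts) (lp_box V) a [set: 'I_m]%SET.
pose LV := large_violation Pr (lp_lhs V) (lp_rhs V) (lp_objectives ts) (lp_box V)
  epsilon : set (m.-tuple (borel_cV R nx)).
have mLV : measurable LV.
  exact: (measurable_large_violation Pr (@measurable_lp_lhs _ _ _ V)
    (@continuous_lp_rhs _ _ _ V) (@cvx_lp_rhs _ _ _ V) objs cB (@cvx_lp_box _ _ _ V)
    (lp_box0 V) (@lp_lhs_le _ _ _ V)).
have mt : measurable_fun setT t.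
  apply/measurable_fun_tnthP => i; rewrite (_ : _ \o _ = ws i)//.
  by apply/funext => o; rewrite /= tnth_mktuple.
(* The samples are i.i.d., so their joint law is the power law, and [conf] converts
   [violation_bound] at [x = expR (-1)] into [gamma]. The program has [nx.+1] variables, whence the
   exponent [nx]. *)
have PLV : (P (t @^-1` LV) <= gamma%:E)%E.
  have [mu hmu] := exists_power_law Pr m.
  rewrite (power_law_transfer hmu mt) => [|D mD|]; last exact: mLV.
    rewrite -[mu LV]fineK ?fin_num_measure// lee_fin; apply: conf.
    apply: (violation_bound (@lp_coordP _ nx) (@continuous_lp_coord _ _)
      (@measurable_lp_lhs _ _ _ V)
      (@continuous_lp_rhs _ _ _ V) (@cvx_lp_rhs _ _ _ V) objs cB (@cvx_lp_box _ _ _ V)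
      (lp_box0 V) (@lp_lhs_le _ _ _ V) hmu nm heps).
    by rewrite expR_gt0 expR_le1 lerN10.
  have [law indep] := hws.
  rewrite (_ : t @^-1` _ = [set o | forall i, D i (ws i o)]).
    by rewrite indep//; apply: eq_bigr => i _; exact: law.
  by apply/seteqP; split=> o Do i; have := Do i; rewrite tnth_mktuple.
have mS : measurable (law_support Pr : set (borel_cV R nx)).
  by apply: measurable_closed_cV; exact: closed_law_support.
have PSC : Pr (~` law_support Pr) = 0%E.
  by rewrite probability_setC// law_support_full subee.
(* The tie-break rule singles out one optimiser only for samples in the support, which has full
   measure. *)
have ws_support : {ae P, forall o, forall i, law_support Pr (ws i o)}.
  apply: filter_forall => i; exists (ws i @^-1` ~` law_support Pr); split=> //.
    by rewrite -[X in measurable X]setTI; apply: measurable_funP => //; exact: measurableC.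
  by rewrite hws.1//; exact: measurableC.
have aeI (Q1 Q2 : set Om) : almost_everywhere P Q1 -> almost_everywhere P Q2 ->
    almost_everywhere P (Q1 `&` Q2) by exact: filterI.
have good := aeI _ _ hy (aeI _ _ hv (aeI _ _ hnuk (aeI _ _ hsc (aeI _ _ hv1 ws_support)))).
apply: (prob_ge_setC _ PLV good).
  by rewrite -[X in measurable X]setTI; exact: mt.
move=> o noLV /contrapT[yo [vo [nuko [sco [v1o wso]]]]] feas_k.
have zE : (y o, beta o) = Z (t o) := lp_optimiser_scenario hts hPrW hWc wso yo.
have box : lp_box V (y o, beta o).
  by have [[_ ?] _] := lexmin_sub yo.
have [s_con _] := sco feas_k.
pose viol := [set w : borel_cV R nx | 0 < excess (lp_lhs V) (lp_rhs V) w (Z (t o))].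
have mviol : measurable viol.
  by apply: (@measurable_violation _ _ _ _ _ _ _ _ _ _ (@measurable_lp_lhs _ _ _ V)
    (@continuous_lp_rhs _ _ _ V) (@cvx_lp_rhs _ _ _ V) objs cB (@cvx_lp_box _ _ _ V)
    (lp_box0 V) (@lp_lhs_le _ _ _ V) _ _ _ (fun=> t o) id).
apply: (@prob_ge_setC _ _ _ Pr viol (~` law_support Pr)) => //.
- by rewrite leNgt; apply/negP.
- by exists (~` law_support Pr); split=> //; exact: measurableC.
move=> w /negP; rewrite -leNgt => + /contrapT Sw; rewrite -zE => exc.
have Ww := excess_homothet hWc box vo (hPrW _ Sw) exc.
have xE : x1 o w = A *m x o + B *m (K *m x o + first_block nu N *m c o) + w.
  by rewrite hx1 hu.
rewrite /= xE hh1 hShat1.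
(* No update takes place, so the tube and the bounds [h] at time k+1 are those of time k. *)
have [-> ->] := (v1o w Sw).1 Ww.
rewrite -hShat -hh hShat.
apply: (opt_feasible_shift _ hPhi hPhis hWc hrho hr _ _ Ww); first exact: nuko.
by rewrite -hShat; exact: s_con.
Qed.
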